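(* Let $d\ge 1$, let $T>0$, let $\Omega\subset\mathbb{R}^d$ be a bounded open domain, and let $\mathbf{A}:\mathbb{R}^d\times[0,T]\to\mathbb{R}^d$ be continuous with continuous first-order partial derivatives and with $\sup_{\mathbf{x}\in\mathbb{R}^d,\,t\in[0,T]}\|\nabla_{\mathbf{x}}\mathbf{A}(\mathbf{x},t)\|_{\mathrm{op}}\le L_A$ for some constant $L_A>0$. Let $\widetilde{U}_0\in L^2(\widetilde{\Omega}(0))$, where $\widetilde{\Omega}(t)=\operatorname{D}^{\mathbf{A}}_{T\to t}(\Omega)$. Then there exists $U(\mathbf{x},t)\in L^1([0,T],H(\widetilde{\Omega}(t)))$ which is a solution of the integral invariant model with initial data $\widetilde{U}_0$.
   Context: All functions are real-valued. $\nabla_{\mathbf{x}}\mathbf{A}$ is the spatial Jacobian matrix and $\|\cdot\|_{\mathrm{op}}$ is the operator norm induced by the Euclidean norm. Flow map. Under the stated assumptions on $\mathbf{A}$, for all $t_1,t_2\in[0,T]$ the map $\operatorname{D}^{\mathbf{A}}_{t_1\to t_2}:\mathbb{R}^d\to\mathbb{R}^d$ is defined by $\operatorname{D}^{\mathbf{A}}_{t_1\to t_2}(\mathbf{x})=\mathbf{s}(t_2)=\mathbf{x}+\int_{t_1}^{t_2}\mathbf{A}(\mathbf{s}(\tau),\tau)\,\mathrm{d}\tau$, where $\mathbf{s}$ is the solution on $[0,T]$ of $\frac{\mathrm{d}\mathbf{s}}{\mathrm{d}\tau}=\mathbf{A}(\mathbf{s},\tau)$ with $\mathbf{s}(t_1)=\mathbf{x}$.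 It is invertible with inverse $\operatorname{D}^{\mathbf{A}}_{t_2\to t_1}$. Set $\widetilde{\Omega}(t)=\operatorname{D}^{\mathbf{A}}_{T\to t}(\Omega)$ for $t\in[0,T]$ (so $\widetilde\Omega(T)=\Omega$). Function spaces. $H(G)$ denotes $L^2(G)$ with the $L^2$-inner product. $H_0(\Omega)=\{f\in L^2(\mathbb{R}^d):\operatorname{supp} f\subset\subset\Omega\}$ (the support is a compact subset of $\Omega$). $L^1([0,T],H(\widetilde{\Omega}(t)))$ is the set of $U$ such that $U(\cdot,t)\in L^2(\widetilde{\Omega}(t))$ for every $t\in[0,T]$ and the map $t\mapsto\|U(\cdot,t)\|_{L^2(\widetilde{\Omega}(t))}$ belongs to $L^1([0,T])$. Test functions. For $\Psi\in H_0(\Omega)$ and $t\in[0,T]$, $\psi(\mathbf{x},t)=\operatorname{\Phi}^{\mathbf{A}}_{T\to t}[\Psi](\mathbf{x}):=\Psi(\operatorname{D}^{\mathbf{A}}_{t\to T}(\mathbf{x}))$ for $\mathbf{x}\in\widetilde{\Omega}(t)$. Solution of the integral invariant model. Given $\widetilde{U}_0\in L^2(\widetilde{\Omega}(0))$ (extended by zero to $\mathbb{R}^d$), a function $U\in L^1([0,T],H(\widetilde{\Omega}(t)))$ is a solution of the integral invariant model with initial data $\widetilde{U}_0$ if $U(\cdot,0)=\widetilde{U}_0$ in $\widetilde{\Omega}(0)$ and, for every $\Psi\in H_0(\Omega)$, with $\psi(\mathbf{x},t)=\Psi(\operatorname{D}^{\mathbf{A}}_{t\to T}(\mathbf{x}))$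 for $\mathbf{x}\in\widetilde{\Omega}(t)$, $t\in[0,T]$, one has $\frac{\mathrm{d}}{\mathrm{d}t}\int_{\widetilde{\Omega}(t)}U(\mathbf{x},t)\psi(\mathbf{x},t)\,\mathrm{d}\mathbf{x}=0$ on $[0,T]$; equivalently, $\int_{\widetilde{\Omega}(t)}U(\mathbf{x},t)\psi(\mathbf{x},t)\,\mathrm{d}\mathbf{x}=\int_{\widetilde{\Omega}(0)}\widetilde{U}_0(\mathbf{x})\psi(\mathbf{x},0)\,\mathrm{d}\mathbf{x}$ for all $t\in[0,T]$. Equality of $L^2$ functions is almost-everywhere equality. *)

(* Defs.v *)
From HB Require Import structures.
From mathcomp Require Import all_boot all_order all_algebra.
From mathcomp Require Import all_classical all_reals all_analysis.

Set Implicit Arguments.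
Unset Strict Implicit.
Unset Printing Implicit Defensive.

Import Order.TTheory GRing.Theory Num.Theory.
Import numFieldNormedType.Exports.

Local Open Scope classical_set_scope.
Local Open Scope ring_scope.

(* Euclidean space of dimension d.+1 is 'rV[R]_d.+1 ; its library norm is the
   sup norm, which has the same open, bounded and compact sets as the Euclidean
   one. The Euclidean norm is used where it matters, in the operator norm. *)

Section LebesgueMeasure.
Context {R : realType} {d : nat}.
Local Notation V := 'rV[R]_d.+1.

Definition open_box (ab : V * V) : set V :=
  [set x | forall i, ab.1 ord0 i < x ord0 i < ab.2 ord0 i].

Definition box_volume (ab : V * V) : R :=
  \prod_(i < d.+1) (ab.2 ord0 i - ab.1 ord0 i).

Definition box_cover (X : set V) : set (nat -> V * V) :=
  [set F : nat -> V * V | (forall k i, (F k).1 ord0 i <= (F k).2 ord0 i) /\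
           X `<=` \bigcup_k open_box (F k)].

Definition lebesgue_outer (X : set V) : \bar R :=
  ereal_inf [set (\sum_(k <oo) (box_volume (F k))%:E)%E | F in box_cover X].

Lemma box_volume_ge0 X (F : nat -> V * V) k : box_cover X F -> 0 <= box_volume (F k).
Proof. by case=> le_F _; apply: prodr_ge0 => i _; rewrite subr_ge0. Qed.

Lemma le_lebesgue_outer :
  {homo lebesgue_outer : X Y / X `<=` Y >-> (X <= Y)%E}.
Proof.
move=> X Y XY; apply/ereal_inf_le_tmp => _ [F [le_F YF] <-].
by exists F => //; split => //; apply: subset_trans XY YF.
Qed.

Lemma lebesgue_outer_ge0 X : (0 <= lebesgue_outer X)%E.
Proof.
apply: le_ereal_inf_tmp => _ [F XF <-].
by apply: nneseries_ge0 => k _ _; rewrite lee_fin (box_volume_ge0 k XF).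
Qed.

Lemma lebesgue_outer0 : lebesgue_outer set0 = 0%E.
Proof.
apply/eqP; rewrite eq_le lebesgue_outer_ge0 andbT.
apply: ereal_inf_lbound; exists (fun=> (0, 0)); first by split.
apply: eseries0 => k _ _.
by rewrite /box_volume big_ord_recl /= subrr mul0r.
Qed.

Lemma lebesgue_outer_sigma_subadditive : sigma_subadditive lebesgue_outer.
Proof.
move=> X; have [[i ioo]|] := pselect (exists i, lebesgue_outer (X i) = +oo%E).
  rewrite (eseries_pinfty _ _ ioo) ?leey// => n _.
  by rewrite -ltNye (lt_le_trans _ (lebesgue_outer_ge0 _)).
rewrite -forallNE => Xoo.
suff add2e (e : {posnum R}) : (lebesgue_outer (\bigcup_n X n) <=
    \sum_(i <oo) lebesgue_outer (X i) + e%:num%:E)%E.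
  by apply/lee_addgt0Pr => _/posnumP[].
rewrite (le_trans _ (epsilon_trick _ _ _))//; last first.
  by move=> n; exact: lebesgue_outer_ge0.
pose P n (F : nat -> V * V) := box_cover (X n) F /\
  (\sum_(k <oo) (box_volume (F k))%:E <=
   lebesgue_outer (X n) + (e%:num / (2 ^ n.+1)%:R)%:E)%E.
have [G PG] : {G : nat -> nat -> V * V & forall n, P n (G n)}.
  apply: (@choice _ _ P) => n; rewrite /P /lebesgue_outer.
  set S := (X in ereal_inf X); move infS : (ereal_inf S) => iS.
  case: iS infS => [r Sr|Soo|Soo].
  - have en1 : 0 < e%:num / (2 ^ n.+1)%:R by [].
    have /(lb_ereal_inf_adherent en1) : ereal_inf S \is a fin_num by rewrite Sr.
    by move=> [x [F XF <-] xS]; exists F; split => //; rewrite -Sr; exact/ltW.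
  - by have := Xoo n; rewrite /lebesgue_outer Soo.
  - have := lebesgue_outer_ge0 (X n); rewrite /lebesgue_outer -/S Soo.
    by rewrite leeNy_eq.
pose v (p : nat * nat) : \bar R := (box_volume (uncurry G p))%:E.
have v_ge0 p : (0 <= v p)%E.
  by case: p => n k; rewrite lee_fin; exact: (box_volume_ge0 k (PG n).1).
apply: (@le_trans _ _ (\esum_(i in setT) v i)%E).
  apply: ereal_inf_lbound => /=.
  have /card_esym/ppcard_eqP[f] := card_nat2.
  exists (uncurry G \o f).
    split => [k i|x [n _] /(PG n).1.2[k _ Gx]].
      by rewrite /=; case: (f k) => n m; exact: (PG n).1.1.
    by exists (f^-1%FUN (n, k)) => //=; rewrite invK ?inE.
  rewrite -(esum_pred_image v _ xpredT) ?[fun=> _]set_true//.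
  by rewrite image_eq.
rewrite (_ : esum _ _ = \sum_(i <oo) \sum_(j <oo) v (i, j))%E; last first.
  pose J : nat -> set (nat * nat) := fun i => [set (i, j) | j in setT].
  rewrite (_ : setT = \bigcup_k J k); last first.
    by rewrite predeqE => -[a b]; split => // _; exists a => //; exists b.
  rewrite esum_bigcupT /=; last 2 first.
    - apply/trivIsetP => i j _ _ ij.
      rewrite predeqE => -[n m] /=; split => //= -[] [_] _ [<-{n} _].
      by move=> [m' _] [] /esym/eqP; rewrite (negbTE ij).
    - by move=> p; exact: v_ge0.
  rewrite -(image_id [set: nat]) -fun_true esum_pred_image//; last first.
    by move=> n _; exact: esum_ge0.
  apply: eq_eseriesr => /= j _.
  rewrite -(esum_pred_image v (pair j) predT)//=; last first.
    by move=> ? ? _ _; exact: (@can_inj _ _ _ snd).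
  by congr esum; rewrite predeqE => -[a b]; split; move=> [i _ <-]; exists i.
apply: lee_nneseries => n _; last exact: (PG n).2.
by move=> *; exact: nneseries_ge0.
Qed.

HB.instance Definition _ := isOuterMeasure.Build R V lebesgue_outer
  lebesgue_outer0 lebesgue_outer_ge0 le_lebesgue_outer
  lebesgue_outer_sigma_subadditive.

End LebesgueMeasure.

Definition lebesgue_outer_measure (R : realType) (d : nat) :
  {outer_measure set 'rV[R]_d.+1 -> \bar R} := lebesgue_outer.

(* Restriction of the outer measure to the Lebesgue measurable sets; the
   measurable type is a copy of 'rV[R]_d.+1 *)
Definition lebesgueV {R : realType} {d : nat} :
    {measure set (caratheodory_type (lebesgue_outer_measure R d)) -> \bar R} :=
  [the measure _ _ of
    (lebesgue_outer_measure R d :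
      set (caratheodory_type (lebesgue_outer_measure R d)) -> \bar R)].

Section VectorCalculus.
Context {R : realType} {d : nat}.
Local Notation V := 'rV[R]_d.+1.

Definition euclidean_norm (v : V) : R := Num.sqrt (\sum_i v ord0 i ^+ 2).

Definition operator_norm (M : 'M[R]_d.+1) : R :=
  sup [set euclidean_norm (v *m M) | v in [set v | euclidean_norm v <= 1]].

(* The i-th row is the partial derivative of A(., t) with respect to x_i, so
   that [v *m spatial_jacobian A x t] is the Jacobian applied to [v]; this is
   the row-vector convention of the library's ['J]. *)
Definition spatial_jacobian (A : V -> R -> V) (x : V) (t : R) : 'M[R]_d.+1 :=
  \matrix_(i < d.+1) 'D_(delta_mx ord0 i) (A ^~ t) x.

(* Derivative relative to I: one-sided at the end points of an interval. *)
Definition has_derivative_on (W : normedModType R) (I : set R) (f g : R -> W) :=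
  forall t, I t ->
    (s - t)^-1 *: (f s - f t) @[s --> within I t^'] --> g t.

Definition C1_on_slab (T : R) (A : V -> R -> V) :=
  let slab : set (V * R) := setT `*` `[0, T] in
  [/\ {within slab, continuous (fun z => A z.1 z.2)},
      forall i : 'I_d.+1,
        (forall x t, t \in `[0, T] -> derivable (A ^~ t) x (delta_mx ord0 i)) /\
        {within slab, continuous
          (fun z => 'D_(delta_mx ord0 i) (A ^~ z.2) z.1)}
    & exists dtA : V -> R -> V,
        (forall x, has_derivative_on `[0, T] (A x) (dtA x)) /\
        {within slab, continuous (fun z => dtA z.1 z.2)}].

End VectorCalculus.

Section Flow.
Context {R : realType} {d : nat}.
Local Notation V := 'rV[R]_d.+1.
Variables (T : R) (A : V -> R -> V).

Definition ode_solution (t1 : R) (x : V) : set (R -> V) :=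
  [set s | s t1 = x /\
           has_derivative_on `[0, T] s (fun tau => A (s tau) tau)].

(* Solutions agree on [0, T] when A is Lipschitz in x, so the choice made by
   xget is irrelevant there; cst x is a default used only if none exists. *)
Definition flow (t1 t2 : R) (x : V) : V := xget (cst x) (ode_solution t1 x) t2.

Definition moving_domain (Omega : set V) (t : R) : set V := flow T t @` Omega.

End Flow.

Section FunctionSpaces.
Context {R : realType} {d : nat}.
Local Notation V := 'rV[R]_d.+1.

Definition L2 (G : set V) (f : V -> R) :=
  f \_ G \in Lfun (@lebesgueV R d) 2%:E.

Definition L2_norm (G : set V) (f : V -> R) : \bar R :=
  'N[@lebesgueV R d]_(2%:E)[EFin \o f \_ G].

(* Complement of the largest open set on which f vanishes almost everywhere:
   the support of f as an element of L^2, insensitive to null sets. *)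
Definition essential_support (f : V -> R) : set V :=
  ~` \bigcup_(O in [set O : set V |
       open O /\ {ae @lebesgueV R d, forall x, O x -> f x = 0}]) O.

Definition H0 (Omega : set V) : set (V -> R) :=
  [set f | [/\ L2 setT f, compact (essential_support f)
             & essential_support f `<=` Omega]].

Definition L1_L2 (T : R) (G : R -> set V) : set (V -> R -> R) :=
  [set U | (forall t, t \in `[0, T] -> L2 (G t) (U ^~ t)) /\
           (@lebesgue_measure R).-integrable `[0, T]
             (fun t => L2_norm (G t) (U ^~ t))].

End FunctionSpaces.

Section IntegralInvariantModel.
Context {R : realType} {d : nat}.
Local Notation V := 'rV[R]_d.+1.
Variables (T : R) (A : V -> R -> V) (Omega : set V).

Definition test_function (Psi : V -> R) (x : V) (t : R) : R :=
  Psi (flow T A t T x).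

Definition is_solution (U0 : V -> R) (U : V -> R -> R) :=
  [/\ L1_L2 T (moving_domain T A Omega) U,
      {ae @lebesgueV R d, forall x, moving_domain T A Omega 0 x -> U x 0 = U0 x}
    & forall Psi, H0 Omega Psi ->
        has_derivative_on (W := R^o) `[0, T]
          (fun t => \int[@lebesgueV R d]_(x in moving_domain T A Omega t)
                      (U x t * test_function Psi x t))
          (cst 0)].

End IntegralInvariantModel.

(* Main.v *)
Require Import Defs.
From mathcomp Require Import all_boot all_order all_algebra.
From mathcomp Require Import all_classical all_reals all_analysis.
From mathcomp Require Import measurable_realfun ring lra.
Import Order.TTheory GRing.Theory Num.Theory.
Import numFieldNormedType.Exports.
Local Open Scope classical_set_scope.
Local Open Scope ring_scope.

(* By Gronwall, the flow from time s to time t is Lipschitz for the sup norm with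
   constant exp (k |t - s|). A map that is K-Lipschitz for the sup norm sends
   cubes into cubes, hence multiplies Lebesgue measure in dimension n by at most
   K ^ n. So E |-> |flow_{0->t} E| has a Radon-Nikodym density G_t, which
   replaces the Jacobian determinant, and
     U (x, t) = U0 (y) / G_t (y),  y = flow_{t->0} x,
   is a solution. Moreover G_s <= exp (n k |t - s|) G_t almost everywhere, so
   exp (- n k t) times the squared L^2 norm of U (., t), which is the integral
   of U0 ^ 2 / G_t, is nonincreasing in t; in particular the norm is a bounded
   measurable function of t. *)

Set Implicit Arguments.
Unset Strict Implicit.

(** * Derivatives relative to a set *)

(** The flow is never differentiated in the space variable: only its Lipschitz bound is available
    here, which is why a Radon-Nikodym density stands in for the Jacobian determinant, and why the
    sup norm, whose balls are cubes, is the convenient one. The integral of G_t over E is the volume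
    of flow_{0->t} E, so the volume bound for flow_{t->s} turns into an inequality between
    densities. Taken against G_0 = 1, it also yields G_t > 0 almost everywhere, so that dividing by
    G_t loses nothing. The densities are chosen independently for each t, hence nothing is known a
    priori about the dependence of G_t on t; the monotonicity of the discounted norm is what
    supplies measurability in time. The measurable sets are those of Caratheodory, not just the
    Borel sets, so continuity of the flow does not by itself make it measurable; preservation of
    null sets closes the gap. *)

Section RowVectors.
Context {R : realType} {d : nat}.
Local Notation V := 'rV[R]_d.+1.

Lemma coord_le_norm (v : V) i : `|v ord0 i| <= `|v|.
Proof.
rewrite [`|v|]/Num.norm/= mx_normrE.
exact: (@le_bigmax _ _ _ 0 (fun ij : 'I_1 * 'I_d.+1 => `|v ij.1 ij.2|) (ord0, i)).
Qed.

Lemma row_norm_le (v : V) (a : R) :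
  0 <= a -> (forall i, `|v ord0 i| <= a) -> `|v| <= a.
Proof.
move=> a0 va; rewrite [`|v|]/Num.norm/= mx_normrE; apply: bigmax_le => //.
by move=> [i j] _ /=; rewrite (ord1 i).
Qed.

Lemma cvg_row {T : Type} (F : set_system T) {FF : Filter F} (f : T -> V) (l : V) :
  f x @[x --> F] --> l <-> forall i, f x ord0 i @[x --> F] --> l ord0 i.
Proof.
split=> [fl i|fl].
  have ci : (fun M : V => M ord0 i) M @[M --> l] --> l ord0 i.
    exact: coord_continuous.
  exact: (cvg_comp _ _ fl ci).
apply/cvgrPdist_le => e e0.
have : \forall x \near F, forall i : 'I_d.+1, `|l ord0 i - f x ord0 i| <= e.
  apply: filter_forall => i.
  by have /cvgrPdist_le := fl i; apply.
apply: filterS => x lfx; apply: row_norm_le; first exact: ltW.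
by move=> i; rewrite !mxE.
Qed.

End RowVectors.

Section DerivativeOn.
Context {R : realType}.
Implicit Types (I : set R).

Lemma quotient_approx (W : normedModType R) (w l : W) (h e : R) : h != 0 ->
  (`|l - h^-1 *: w| <= e) = (`|w - h *: l| <= e * `|h|).
Proof.
move=> h0; rewrite -[in RHS]normrN opprB.
rewrite (_ : h *: l - w = h *: (l - h^-1 *: w)); last first.
  by rewrite scalerBr scalerA divff// scale1r.
by rewrite normrZ mulrC ler_pM2r// normr_gt0.
Qed.

(** Once the denominator is cleared, the estimate is trivial at [s = t], so the punctured
    neighborhood becomes a plain one. *)
Lemma has_derivative_onP (W : normedModType R) I (f g : R -> W) :
  has_derivative_on I f g <-> forall t, I t -> forall e, 0 < e ->
    \forall s \near t, I s -> `|f s - f t - (s - t) *: g t| <= e * `|s - t|.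
Proof.
split=> fg t It.
  move=> e e0; have /cvgrPdist_le/(_ _ e0) H := fg t It.
  have {}H : \forall s \near t, s != t -> I s ->
    `|g t - (s - t)^-1 *: (f s - f t)| <= e by [].
  near=> s => Is.
  have [->|st] := eqVneq s t; first by rewrite !subrr scale0r subrr !normr0 mulr0.
  rewrite -quotient_approx ?subr_eq0//.
  by move: st Is; near: s.
apply/cvgrPdist_le => e e0.
change (\forall s \near t, s != t -> I s ->
    `|g t - (s - t)^-1 *: (f s - f t)| <= e).
near=> s => st Is; rewrite quotient_approx ?subr_eq0//.
by move: Is; near: s; exact: fg.
Unshelve. all: by end_near. Qed.

Lemma is_deriveP (f : R -> R) (t l : R) :
  is_derive t 1 f l <-> forall e, 0 < e ->
    \forall s \near t, `|f s - f t - (s - t) * l| <= e * `|s - t|.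
Proof.
have E : (forall e, 0 < e ->
    \forall s \near t, `|f s - f t - (s - t) * l| <= e * `|s - t|) <->
    h^-1 *: (f (h *: (1 : R) + t) - f t) @[h --> (0 : R)^'] --> l.
  have A h e : h != 0 -> (`|l - h^-1 *: (f (h *: (1 : R) + t) - f t)| <= e) =
      (`|f (t + h) - f t - (t + h - t) * l| <= e * `|t + h - t|).
    by move=> h0; rewrite (@quotient_approx R^o)// [h *: 1]mulr1 (addrC t h) addrK.
  split=> H.
    apply/cvgrPdist_le => e e0.
    change (\forall h \near (0 : R), h != 0 ->
      `|l - h^-1 *: (f (h *: (1 : R) + t) - f t)| <= e).
    have /(@nbhs0P R R^o) {}H := H e e0.
    by near=> h => h0; rewrite A//; near: h.
  move=> e e0; apply/(@nbhs0P R R^o).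
  have /cvgrPdist_le/(_ _ e0) {}H := H.
  have {}H : \forall h \near (0 : R), h != 0 ->
      `|l - h^-1 *: (f (h *: (1 : R) + t) - f t)| <= e by [].
  near=> h; have [->|h0] := eqVneq h 0.
    by rewrite addr0 !subrr mul0r subrr normr0 mulr0.
  by rewrite -A//; move: h0; near: h.
rewrite E; split=> [[df <-]|fl]; first exact: df.
apply: DeriveDef; first by apply/cvg_ex; exists l.
exact/cvg_lim.
Unshelve. all: by end_near. Qed.

Lemma has_derivative_on_continuous (W : normedModType R) I (f g : R -> W) t :
  has_derivative_on I f g -> I t -> f @ within I (nbhs t) --> f t.
Proof.
move=> /has_derivative_onP fg It; apply/cvgrPdist_le => e e0.
change (\forall s \near t, I s -> `|f t - f s| <= e).
have K0 : 0 < `|g t| + 1 by rewrite ltr_wpDl.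
near=> s => Is.
have : `|f s - f t - (s - t) *: g t| <= 1 * `|s - t|.
  by move: Is; near: s; exact: fg.
have : `|s - t| <= e / (`|g t| + 1).
  by near: s; apply: cvgr_distC_le => //; exact: divr_gt0.
rewrite mul1r ler_pdivlMr// => st H.
rewrite -normrN opprB -[f s - f t](subrK ((s - t) *: g t)).
apply: le_trans (ler_normD _ _) _; apply: le_trans st.
by rewrite mulrDr mulr1 addrC normrZ lerD.
Unshelve. all: by end_near. Qed.

Lemma has_derivative_on_is_derive (a b : R) (f g : R -> R) t :
  has_derivative_on (W := R^o) `[a, b] f g -> a < t < b -> is_derive t 1 f (g t).
Proof.
move=> /has_derivative_onP fg atb; apply/is_deriveP => e e0.
have It : `[a, b]%classic t by case/andP: atb => ? ?; rewrite /= in_itv/= !ltW.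
near=> s; have : `[a, b]%classic s.
  apply: subset_itv_oo_cc; near: s; apply: near_in_itvoo.
  by rewrite in_itv.
by near: s; exact: fg.
Unshelve. all: by end_near. Qed.

Lemma is_derive_has_derivative_on I (f g : R -> R) :
  (forall t, I t -> is_derive t 1 f (g t)) ->
  has_derivative_on (W := R^o) I f g.
Proof.
move=> fg; apply/has_derivative_onP => t /fg/is_deriveP fgt e e0.
by apply: filterS (fgt e e0).
Qed.

End DerivativeOn.

Section Comparison.
Context {R : realType} {d : nat} (a b : R).
Local Notation V := 'rV[R]_d.+1.
Local Notation I := `[a, b]%classic.

Lemma has_derivative_on_row (f g : R -> V) :
  has_derivative_on I f g <-> forall i, has_derivative_on (W := R^o) I
    (fun t => f t ord0 i) (fun t => g t ord0 i).
Proof.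
split=> [fg i t It|fg t It].
  have /cvg_row/(_ i) := fg t It.
  by apply: cvg_trans; apply: near_eq_cvg; apply: nearW => s; rewrite !mxE.
apply/cvg_row => i; have := fg i t It.
by apply: cvg_trans; apply: near_eq_cvg; apply: nearW => s; rewrite !mxE.
Qed.

Lemma has_derivative_on_itv_continuous (W : normedModType R) (f g : R -> W) :
  has_derivative_on I f g -> {within I, continuous f}.
Proof.
move=> fg; apply/subspace_continuousP => t It.
exact: has_derivative_on_continuous fg It.
Qed.

(** By the mean value theorem [phi - f] and [phi + f] are both nondecreasing on [x, y]. A majorant
    [phi] with explicit derivative thus replaces the integral of the bound on [g]. *)
Lemma le_increment (f g phi phi' : R -> R) (x y : R) :
  has_derivative_on (W := R^o) I f g ->
  (forall z : R, is_derive z 1 phi (phi' z)) ->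
  (forall z, x <= z <= y -> `|g z| <= phi' z) ->
  a <= x -> x <= y -> y <= b -> `|f y - f x| <= phi y - phi x.
Proof.
move=> fg phiD gphi ax; rewrite le_eqVlt => /predU1P[->|xy] yb.
  by rewrite !subrr normr0.
have fc : {within `[x, y], continuous f}.
  apply: continuous_subspaceW (has_derivative_on_itv_continuous fg).
  by apply: subset_itv; rewrite bnd_simp.
have phic : {within `[x, y], continuous phi}.
  apply: continuous_subspaceT => z; apply/differentiable_continuous.
  by rewrite -derivable1_diffP; have [] := phiD z.
have fD z : z \in `]x, y[%R -> is_derive z 1 f (g z).
  rewrite in_itv/= => /andP[xz zy]; apply: has_derivative_on_is_derive fg _.
  by rewrite (le_lt_trans ax xz) (lt_le_trans zy yb).
have H (k : R -> R) k' : {within `[x, y], continuous k} ->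
    (forall z, z \in `]x, y[%R -> is_derive z 1 k (k' z)) ->
    (forall z, x <= z <= y -> 0 <= k' z) -> k x <= k y.
  move=> kc kD k0; have [c cxy /eqP] := MVT xy kD kc.
  rewrite -subr_ge0 => /eqP ->; apply: mulr_ge0; last by rewrite subr_ge0 ltW.
  by apply: k0; move: cxy; rewrite in_itv/= => /andP[xc cy]; rewrite !ltW.
have Hm : phi x - f x <= phi y - f y.
  apply: (H (phi - f) (fun z => phi' z - g z)) => //.
  - by move=> z; apply: cvgB; [exact: phic|exact: fc].
  - by move=> z /fD ?; apply: is_deriveB.
  - by move=> z /gphi/ler_normlW; rewrite subr_ge0.
have Hp : phi x + f x <= phi y + f y.
  apply: (H (phi + f) (fun z => phi' z + g z)) => //.
  - by move=> z; apply: cvgD; [exact: phic|exact: fc].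
  - by move=> z /fD ?; apply: is_deriveD.
  - by move=> z /gphi; rewrite ler_norml => /andP[+ _]; lra.
by rewrite ler_norml; apply/andP; split; lra.
Qed.

(* The bound on the derivative at [z] is a function of the distance to the
   base point [x], so that one statement covers both time directions. *)
Lemma le_increment_dist (f g phi phi' : R -> R) (x y : R) :
  has_derivative_on (W := R^o) I f g ->
  (forall z : R, is_derive z 1 phi (phi' z)) ->
  (forall z, I z -> `|g z| <= phi' `|z - x|) ->
  I x -> I y -> `|f y - f x| <= phi `|y - x| - phi 0.
Proof.
move=> fg phiD gphi /=; rewrite !in_itv/= => /andP[ax xb] /andP[ay yb].
have [xy|/ltW yx] := leP x y.
  have D (z : R) : is_derive z 1 (fun z => phi (z - x)) (phi' (z - x)).
    rewrite -[phi' _]mulr1; apply: (@is_derive1_comp _ phi (fun z => z - x)) => //.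
    by apply: is_derive_eq; rewrite subr0.
  have gD z : x <= z <= y -> `|g z| <= phi' (z - x).
    move=> /andP[xz zy]; rewrite -[z - x]ger0_norm ?subr_ge0//.
    by apply: gphi; rewrite /= in_itv/= (le_trans ax xz) (le_trans zy yb).
  have := le_increment fg D gD ax xy yb.
  by rewrite subrr [`|y - x|]ger0_norm ?subr_ge0.
(* Backwards in time the majorant is reflected: [- phi (x - z)] again has derivative [phi'] at the
   distance to [x]. *)
have D (z : R) : is_derive z 1 (fun z => - phi (x - z)) (phi' (x - z)).
  rewrite -[phi' _]opprK; apply: is_deriveN; rewrite -mulrN1.
  apply: (@is_derive1_comp _ phi (fun z => x - z)) => //.
  by apply: is_derive_eq; rewrite add0r mul1r.
have gD z : y <= z <= x -> `|g z| <= phi' (x - z).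
  move=> /andP[yz zx]; rewrite -[x - z]ger0_norm ?subr_ge0// distrC.
  by apply: gphi; rewrite /= in_itv/= (le_trans ay yz) (le_trans zx xb).
have := le_increment fg D gD ay yx xb.
by rewrite subrr opprK [- _ + _]addrC distrC (distrC y x) [`|x - y|]ger0_norm ?subr_ge0.
Qed.

(** The sup norm is not differentiable, so the scalar estimate is applied to each coordinate of
    [f - g], and the common bound passes to the maximum. *)
Lemma le_increment_row (f g u v : R -> V) (phi phi' : R -> R) (x y : R) :
  has_derivative_on I f u -> has_derivative_on I g v ->
  (forall z : R, is_derive z 1 phi (phi' z)) ->
  (forall z, I z -> `|u z - v z| <= phi' `|z - x|) ->
  I x -> I y -> `|f y - g y| <= `|f x - g x| + (phi `|y - x| - phi 0).
Proof.
move=> /has_derivative_on_row fu /has_derivative_on_row gv phiD uv Ix Iy.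
have H i : `|(f y - g y) ord0 i - (f x - g x) ord0 i| <= phi `|y - x| - phi 0.
  pose k t := f t ord0 i - g t ord0 i.
  rewrite !mxE -/(k y) -/(k x).
  apply: (@le_increment_dist k (fun t => u t ord0 i - v t ord0 i) phi phi') => //.
    move=> t It; have := @cvgB _ R^o _ _ _ _ _ _ _ (fu i t It) (gv i t It).
    move=> /(_ (within_filter _ _)).
    apply: cvg_trans; apply: near_eq_cvg; apply: nearW => s.
    by rewrite !fctE -scalerBr; congr (_ *: _); rewrite /k; ring.
  move=> z Iz; apply: le_trans (uv z Iz).
  by apply: le_trans (coord_le_norm _ i); rewrite !mxE.
(* Any coordinate shows this; [ord0] is one because the dimension is [d.+1]. *)
have H0 : 0 <= phi `|y - x| - phi 0 by apply: le_trans (H ord0).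
apply: row_norm_le => [|i]; first by rewrite addr_ge0.
rewrite -[_ ord0 i](subrK ((f x - g x) ord0 i)) addrC.
apply: le_trans (ler_normD _ _) _; apply: lerD => //.
exact: coord_le_norm.
Qed.

End Comparison.

(** * Gronwall and Picard-Lindelof *)

Lemma is_derive_exp_scale (R : realType) (c k z : R) :
  is_derive z 1 (fun r => c * expR (k * r)) (c * (k * expR (k * z))).
Proof.
by apply: is_derive_eq; rewrite /GRing.scale/=; ring.
Qed.

Lemma cvg_half_expn (R : realType) (c : R) : c * 2^-1 ^+ n @[n --> \oo] --> 0.
Proof.
by apply: cvg_geometric; rewrite ger0_norm// invf_lt1// ltr1n.
Qed.

Lemma le_half_expn (R : realType) (x y c : R) :
  (forall n, x <= y + c * 2^-1 ^+ n) -> x <= y.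
Proof.
move=> H; have Hl : y + c * 2^-1 ^+ n @[n --> \oo] --> y.
  by rewrite -[X in _ --> X]addr0; apply: cvgD; [exact: cvg_cst|exact: cvg_half_expn].
by apply: (ler_cvg_to (cvg_cst x) Hl); apply: nearW.
Qed.

Section Antiderivative.
Context {R : realType} {d : nat} (a b : R) (ab : a < b).
Local Notation V := 'rV[R]_d.+1.
Local Notation I := `[a, b]%classic.

(** The retraction of the line onto [a, b]. Composing with it extends a function continuous on the
    interval to one continuous everywhere, so that the end points need no separate treatment. *)
Let clamp (t : R) := Num.max a (Num.min t b).

Let clamp_itv t : I (clamp t).
Proof. by rewrite /= in_itv/= /clamp le_max lexx/= ge_max ltW//= ge_min lexx orbT. Qed.

Let clampK t : I t -> clamp t = t.
Proof. by rewrite /= in_itv/= /clamp => /andP[? ?]; rewrite min_l// max_r. Qed.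

Let continuous_clamp : continuous clamp.
Proof.
move=> t; apply: (@continuous_max _ _ (cst a) (fun s => Num.min s b)).
  exact: cst_continuous.
apply: (@continuous_min _ _ (fun s => s) (cst b)); last exact: cst_continuous.
exact: cvg_id.
Qed.

Lemma antiderivative (h : R -> R) : {within I, continuous h} ->
  exists F, has_derivative_on (W := R^o) I F h.
Proof.
move=> /subspace_continuousP hc.
have hclamp : continuous (h \o clamp).
  move=> t; apply: cvg_comp (hc _ (clamp_itv t)) => P HP.
  have {}HP : \forall x \near clamp t, I x -> P x by [].
  have H : \forall x \near t, I (clamp x) -> P (clamp x).
    exact: continuous_clamp HP.
  by apply: filterS H => x; apply; exact: clamp_itv.
(* Starting at [a - 1], with [b + 1] as upper limit below, leaves every point of the closed
   interval, end points included, strictly inside the range of the fundamental theorem. *)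
exists (fun t => \int[lebesgue_measure]_(x in `[a - 1, t]) (h \o clamp) x)%R.
apply: is_derive_has_derivative_on => t It.
have := @continuous_FTC1_closed R (h \o clamp) (a - 1) t (b + 1). move=> [].
- by move: It; rewrite /= in_itv/= => /andP[_ tb]; rewrite (le_lt_trans tb)// ltrDl.
- apply: continuous_compact_integrable; first exact: segment_compact.
  exact: continuous_subspaceT.
- by move: It; rewrite /= in_itv/= => /andP[at_ _]; rewrite (lt_le_trans _ at_)// gtrDl ltrN10.
- exact: hclamp.
by move=> Fd F'; apply: DeriveDef => //; rewrite -derive1E F' /= clampK.
Qed.

Lemma antiderivative_row (h : R -> V) (t : R) (x : V) : {within I, continuous h} ->
  exists F, F t = x /\ has_derivative_on I F h.
Proof.
move=> hc.
have /choice[F FP] i : exists F, has_derivative_on (W := R^o) I F (fun t => h t ord0 i).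
  by apply: antiderivative => s; have /cvg_row/(_ i) := hc s.
exists (fun s => x + \row_i (F i s - F i t)); split.
  by apply/rowP => i; rewrite !mxE subrr addr0.
apply/has_derivative_on_row => i s Is; apply: cvg_trans (FP i s Is).
apply: near_eq_cvg; apply: nearW => r; rewrite !mxE.
by congr (_ *: _); ring.
Qed.

End Antiderivative.

Section Gronwall.
Context {R : realType} {d : nat} (a b L : R) (A : 'rV[R]_d.+1 -> R -> 'rV[R]_d.+1).
Local Notation V := 'rV[R]_d.+1.
Local Notation I := `[a, b]%classic.
Hypothesis L_gt0 : 0 < L.
Hypothesis A_lip : forall t x y, I t -> `|A x t - A y t| <= L * `|x - y|.

(* Bootstrap: a bound [u0 * exp (L |t - t1|) + M * exp (2 L |t - t1|)] improves
   itself by halving [M], which avoids differentiating the sup norm. *)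
Lemma gronwall (s r : R -> V) t1 t :
  has_derivative_on I s (fun z => A (s z) z) ->
  has_derivative_on I r (fun z => A (r z) z) ->
  I t1 -> I t -> `|s t - r t| <= `|s t1 - r t1| * expR (L * `|t - t1|).
Proof.
move=> sD rD It1 It.
have ab : a <= b.
  by move: It; rewrite /= in_itv/= => /andP[]; exact: le_trans.
have [M sM] : exists M, forall z, I z -> `|s z - r z| <= M.
  have sc : {within I, continuous (fun z => `|s z - r z|)}.
    move=> z; apply: cvg_norm; apply: cvgB.
      exact: (has_derivative_on_itv_continuous sD).
    exact: (has_derivative_on_itv_continuous rD).
  have [c _ cM] := EVT_max ab sc.
  by exists `|s c - r c| => z; exact: cM.
have M0 : 0 <= M by apply: le_trans (sM t It).
set u0 := `|s t1 - r t1|.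
have bound n z : I z -> `|s z - r z| <= u0 * expR (L * `|z - t1|) +
    (M * 2^-1 ^+ n) * expR (2 * L * `|z - t1|).
  elim: n z => [z Iz|n IH z Iz].
    rewrite expr0 mulr1; apply: le_trans (sM z Iz) _.
    rewrite -[leLHS]add0r; apply: lerD; first by rewrite mulr_ge0 ?expR_ge0 ?normr_ge0.
    by rewrite ler_peMr// -[leLHS]expR0 ler_expR !mulr_ge0// ltW.
  (* The majorant [c * expR (2 * L * r)] has derivative [2 * L * c * expR (2 * L * r)], and [2 * c]
     is the previous constant: the factor 2 in the exponent pays for the halving. *)
  pose c := M * 2^-1 ^+ n.+1.
  have D (w : R) := is_deriveD (is_derive_exp_scale u0 L w)
    (is_derive_exp_scale c (2 * L) w).
  have := le_increment_row sD rD D _ It1 Iz.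
  rewrite /= !fctE !mulr0 expR0 !mulr1 -/u0 => H.
  apply: le_trans (H _) _.
    move=> w Iw; apply: le_trans (A_lip _ _ Iw) _.
    apply: le_trans (ler_wpM2l (ltW L_gt0) (IH w Iw)) _.
    rewrite le_eqVlt; apply/orP; left; apply/eqP.
    by rewrite /c exprS; field.
  have c0 : 0 <= c by rewrite mulr_ge0// exprn_ge0.
  by rewrite -/c; lra.
apply: (@le_half_expn _ _ _ (M * expR (2 * L * `|t - t1|))) => n.
by apply: le_trans (bound n t It) _; rewrite lerD2l mulrAC.
Qed.

Lemma within_continuous_slab (s : R -> V) :
  {within [set: V] `*` I, continuous (fun z : V * R => A z.1 z.2)} ->
  {within I, continuous s} -> {within I, continuous (fun t => A (s t) t)}.
Proof.
move=> /subspace_continuousP Ac /subspace_continuousP sc.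
apply/subspace_continuousP => t It.
apply: (@cvg_comp _ _ _ (fun z => (s z, z)) (fun z : V * R => A z.1 z.2) _ _ _ _
  (Ac (s t, t) (conj Logic.I It))) => P HP.
have {}HP : \forall z \near (s t, t), (setT `*` I) z -> P z by [].
have /= H : (s z, z) @[z --> within I (nbhs t)] --> (s t, t).
  exact: (cvg_pair (sc t It) (@cvg_within _ (nbhs t) _ I)).
have {}H : \forall z \near t, I z -> (setT `*` I) (s z, z) -> P (s z, z) by exact: H HP.
change (\forall z \near t, I z -> P (s z, z)).
by apply: filterS H => z Hz Iz; apply: Hz.
Qed.

End Gronwall.

Section Picard.
Context {R : realType} {d : nat} (a b L : R) (A : 'rV[R]_d.+1 -> R -> 'rV[R]_d.+1).
Local Notation V := 'rV[R]_d.+1.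
Local Notation I := `[a, b]%classic.
Hypothesis ab : a < b.
Hypothesis L_gt0 : 0 < L.
Hypothesis A_lip : forall t x y, I t -> `|A x t - A y t| <= L * `|x - y|.
Hypothesis A_cont : {within [set: V] `*` I, continuous (fun z : V * R => A z.1 z.2)}.
Variables (t1 : R) (x : V).
Hypothesis It1 : I t1.

(** One Picard iteration, specified by its initial value and derivative instead of an integral;
    [stepP] shows that the default [s] is not taken when [s] is continuous. *)
Let step (s : R -> V) : R -> V :=
  xget s [set r | r t1 = x /\ has_derivative_on I r (fun z => A (s z) z)].

Let s_ n := iter n step (cst x).

Let stepP s : {within I, continuous s} ->
  step s t1 = x /\ has_derivative_on I (step s) (fun z => A (s z) z).
Proof.
move=> sc; have [F FP] := antiderivative_row ab t1 x (within_continuous_slab A_cont sc).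
exact: (@xgetI _ s [set r | r t1 = x /\ has_derivative_on I r (fun z => A (s z) z)] F).
Qed.

Let s_cont n : {within I, continuous (s_ n)}.
Proof.
elim: n => [|n IH]; first by apply: continuous_subspaceT => z; exact: cvg_cst.
by rewrite /s_ iterS; exact: (has_derivative_on_itv_continuous (stepP IH).2).
Qed.

Let s_init n : s_ n t1 = x.
Proof. by case: n => // n; exact: (stepP (@s_cont n)).1. Qed.

Let s_derive n : has_derivative_on I (s_ n.+1) (fun z => A (s_ n z) z).
Proof. exact: (stepP (@s_cont n)).2. Qed.

(** Bielecki's weight: relative to it, the Picard map is a contraction of ratio 1/2 on the whole
    interval, so no short-time solutions have to be glued together. *)
Let E z := expR (2 * L * `|z - t1|).

Let E_ge1 z : 1 <= E z.
Proof. by rewrite -[leLHS]expR0 ler_expR !mulr_ge0// ltW. Qed.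

(** A derivative bounded by [2 * L * c * E] integrates to at most [c * (E - 1)] on either side of
    [t1], hence to at most [c * E]. *)
Let compare (f g u v : R -> V) (c : R) z :
  has_derivative_on I f u -> has_derivative_on I g v ->
  f t1 = x -> g t1 = x -> 0 <= c ->
  (forall w, I w -> `|u w - v w| <= 2 * L * c * E w) ->
  I z -> `|f z - g z| <= c * E z.
Proof.
move=> fu gv fx gx c0 uv Iz.
have := le_increment_row fu gv (is_derive_exp_scale c (2 * L)) _ It1 Iz.
rewrite fx gx subrr normr0 add0r => H; apply: le_trans (H _) _.
  by move=> w Iw; rewrite mulrA [c * _]mulrC; exact: uv.
by rewrite gerBl mulr0 expR0 mulr1.
Qed.

(** The iterates are uniformly Cauchy and their limit [l] is continuous. Applying one more Picard
    step to [l] and finding [l] again avoids differentiating a limit. *)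
Lemma picard : exists s, s t1 = x /\ has_derivative_on I s (fun z => A (s z) z).
Proof.
have [C C0 HC] : exists2 C, 0 <= C & forall z, I z -> `|s_ 1 z - s_ 0 z| <= C.
  have sc : {within I, continuous (fun z => `|s_ 1 z - s_ 0 z|)}.
    by move=> z; apply: cvg_norm; apply: cvgB; exact: s_cont.
  have [c _ cM] := EVT_max (ltW ab) sc.
  by exists `|s_ 1 c - s_ 0 c| => // z; exact: cM.
have gap n z : I z -> `|s_ n.+1 z - s_ n z| <= C * 2^-1 ^+ n * E z.
  elim: n z => [z Iz|n IH z Iz].
    by rewrite expr0 mulr1 (le_trans (HC z Iz))// ler_peMr.
  apply: (compare (@s_derive n.+1) (@s_derive n)) => //.
    by rewrite mulr_ge0// exprn_ge0.
  move=> w Iw; apply: le_trans (A_lip _ _ Iw) _.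
  apply: le_trans (ler_wpM2l (ltW L_gt0) (IH w Iw)) _.
  by rewrite le_eqVlt; apply/orP; left; apply/eqP; rewrite exprS; field.
(* The sum of the geometric gaps, [2 * C], times the largest value that the weight can take on the
   interval. *)
pose K := 2 * C * expR (2 * L * (b - a)).
have EK z : I z -> 2 * C * E z <= K.
  move=> Iz; rewrite /K ler_wpM2l ?mulr_ge0// ler_expR ler_wpM2l ?mulr_ge0 ?(ltW L_gt0)//.
  move: Iz It1; rewrite /= !in_itv/= => /andP[? ?] /andP[? ?].
  by rewrite ler_norml; apply/andP; split; lra.
have K0 : 0 <= K by rewrite !mulr_ge0 ?expR_ge0.
have far n k z : I z -> `|s_ (n + k) z - s_ n z| <= K * 2^-1 ^+ n.
  (* The exact partial sum of the geometric series is kept: with only [2^-1 ^+ n] on the right the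
     induction on [k] would not close. *)
  move=> Iz; apply: (@le_trans _ _ (2 * C * E z * (2^-1 ^+ n - 2^-1 ^+ (n + k)))).
    elim: k => [|k IH]; first by rewrite addn0 !subrr normr0 mulr0.
    rewrite addnS; apply: le_trans (ler_distD (s_ (n + k) z) _ _) _.
    have := gap (n + k)%N z Iz; rewrite exprS; lra.
  apply: ler_pM; rewrite ?EK ?mulr_ge0 ?gerBl ?subr_ge0 ?exprn_ge0//.
  - exact: le_trans ler01 (E_ge1 z).
  - by apply: ler_wiXn2l; rewrite ?invf_le1 ?ler1n ?leq_addr.
have cvgs z : I z -> cvgn (s_ ^~ z).
  move=> Iz; apply/cauchy_cvgP/cauchy_exP => e e0.
  have /cvgrPdist_lt/(_ _ e0)[n _ Hn] := @cvg_half_expn _ K.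
  exists (s_ n z); exists n => // m /= nm; rewrite -ball_normE /= distrC.
  rewrite -(subnKC nm); apply: le_lt_trans (far n (m - n)%N z Iz) _.
  have := Hn n (leqnn n); rewrite sub0r normrN; exact: le_lt_trans (ler_norm _).
pose l z := lim (s_ n z @[n --> \oo]).
have ls n z : I z -> `|l z - s_ n z| <= K * 2^-1 ^+ n.
  move=> Iz; have H : `|s_ m z - s_ n z| @[m --> \oo] --> `|l z - s_ n z|.
    by apply: cvg_norm; apply: cvgB; [exact: cvgs|exact: cvg_cst].
  apply: (ler_cvg_to H (cvg_cst _)); near=> m.
  by rewrite -(@subnKC n m); [exact: far|near: m; exact: nbhs_infty_ge].
have lc : {within I, continuous l}.
  apply/subspace_continuousP => t It; apply/cvgrPdist_lt => e e0.
  have e3 : 0 < e / 3 by rewrite divr_gt0.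
  have /cvgrPdist_lt/(_ _ e3)[n _ /(_ n (leqnn n))] := @cvg_half_expn _ K.
  rewrite sub0r normrN => /(le_lt_trans (ler_norm _)) Hn.
  have /subspace_continuousP/(_ _ It)/cvgrPdist_lt/(_ _ e3) sn := @s_cont n.
  change (\forall z \near t, I z -> `|l t - l z| < e).
  have {}sn : \forall z \near t, I z -> `|s_ n t - s_ n z| < e / 3 by [].
  apply: filterS sn => z Hz Iz.
  apply: le_lt_trans (ler_distD (s_ n t) _ _) _.
  apply: le_lt_trans (lerD (lexx _) (ler_distD (s_ n z) _ _)) _.
  have := ls n t It; have := ls n z Iz; have := Hz Iz.
  by rewrite (distrC (l z)); lra.
(* [r] is the Picard step of [l]. It is compared with [s_ n.+1], the Picard step of [s_ n]; since
   [l] and [s_ n] differ by at most [K * 2^-1 ^+ n], so up to a constant do [r] and [s_ n.+1], which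
   forces [r = l]. *)
have [r [rx rD]] := antiderivative_row ab t1 x (within_continuous_slab A_cont lc).
have rl z : I z -> r z = l z.
  move=> Iz; apply/eqP; rewrite -subr_eq0 -normr_le0.
  apply: (@le_half_expn _ _ _ (K / 2 * E z + K)) => n; rewrite add0r.
  apply: le_trans (ler_distD (s_ n.+1 z) _ _) _; rewrite mulrDl.
  apply: lerD.
    rewrite mulrAC; apply: (compare rD (@s_derive n)) => //.
      by rewrite mulr_ge0 ?divr_ge0 ?exprn_ge0.
    move=> w Iw; apply: le_trans (A_lip _ _ Iw) _.
    apply: le_trans (ler_wpM2l (ltW L_gt0) (ls n w Iw)) _.
    rewrite (_ : 2 * L * _ = L * (K * 2^-1 ^+ n)); last by field.
    by rewrite ler_peMr// !mulr_ge0// ?exprn_ge0// ltW.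
  rewrite distrC; apply: le_trans (ls n.+1 z Iz) _.
  by rewrite ler_wpM2l// exprS ler_piMl ?exprn_ge0// invf_le1 ?ler1n.
exists r; split=> // t It; have := rD t It; rewrite /= -(rl t It).
Unshelve. all: by end_near. Qed.

End Picard.

(** * The flow *)

Section OperatorNorm.
Context {R : realType} {d : nat}.
Local Notation V := 'rV[R]_d.+1.

Lemma coord_le_euclidean_norm (v : V) i : `|v ord0 i| <= euclidean_norm v.
Proof.
rewrite -sqrtr_sqr /euclidean_norm ler_sqrt; last by apply: sumr_ge0 => k _; exact: sqr_ge0.
by rewrite (bigD1 i)//= lerDl; apply: sumr_ge0 => k _; exact: sqr_ge0.
Qed.

Lemma euclidean_norm_delta (i : 'I_d.+1) :
  euclidean_norm (delta_mx ord0 i : V) = 1.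
Proof.
rewrite /euclidean_norm (bigD1 i)//= mxE !eqxx big1 ?addr0 ?expr1n ?sqrtr1//.
by move=> k ki; rewrite mxE (negbTE ki) andbF expr0n.
Qed.

Lemma entry_le_operator_norm (M : 'M[R]_d.+1) i j : `|M i j| <= operator_norm M.
Proof.
rewrite (_ : M i j = ((delta_mx ord0 i : V) *m M) ord0 j); last by rewrite -rowE mxE.
apply: le_trans (coord_le_euclidean_norm _ _) _.
(* A real [sup] dominates its set only if the set is bounded above, hence the crude bound by column
   sums of absolute values. *)
suff ub : has_ubound [set euclidean_norm (v *m M) | v in [set v | euclidean_norm v <= 1]].
  by apply: (ub_le_sup ub); exists (delta_mx ord0 i : V) => //=; rewrite euclidean_norm_delta.
exists (Num.sqrt (\sum_j (\sum_i `|M i j|) ^+ 2)) => _ [v /= v1 <-].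
rewrite /euclidean_norm ler_sqrt; last by apply: sumr_ge0 => k _; exact: sqr_ge0.
apply: ler_sum => k _; rewrite -real_normK ?num_real//.
rewrite ler_sqr ?nnegrE//; last exact: sumr_ge0.
rewrite mxE; apply: le_trans (ler_norm_sum _ _ _) _; apply: ler_sum => l _.
rewrite normrM ler_piMl//; apply: le_trans v1; exact: coord_le_euclidean_norm.
Qed.

End OperatorNorm.

(** * Lipschitz bounds from partial derivatives *)

Section LipschitzSlice.
Context {R : realType} {d : nat}.
Local Notation V := 'rV[R]_d.+1.
Variables (f : V -> V) (K : R).
Hypothesis f_der : forall i x, derivable f x (delta_mx ord0 i).
Hypothesis f_bound : forall i j x, `|('D_(delta_mx ord0 i) f x) ord0 j| <= K.

Let line_lip (x : V) i (h : R) :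
  `|f (h *: delta_mx ord0 i + x) - f x| <= K * `|h|.
Proof.
have K0 : 0 <= K by apply: le_trans (f_bound ord0 ord0 0).
pose e : V := delta_mx ord0 i.
apply: row_norm_le => [|j]; first exact: mulr_ge0.
pose g (s : R) := f (s *: e + x) ord0 j.
pose g' (s : R) := 'D_e f (s *: e + x) ord0 j.
have gD (s : R) : is_derive s 1 g (g' s).
  have /cvg_row/(_ j) : k^-1 *: (f (k *: e + (s *: e + x)) - f (s *: e + x))
      @[k --> 0^'] --> 'D_e f (s *: e + x) by exact: f_der.
  move=> H.
  have {}H : k^-1 *: (g (k *: (1 : R) + s) - g s) @[k --> (0 : R)^'] --> g' s.
    apply: cvg_trans H; apply: near_eq_cvg; apply: nearW => k.
    by rewrite /g !mxE addrA -scalerDl [k *: 1]mulr1.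
  by apply: DeriveDef; [apply/cvg_ex; exists (g' s)|exact/cvg_lim].
have phiD (z : R) : is_derive z 1 (fun r => K * r) K.
  by apply: is_derive_eq; rewrite /GRing.scale/=; ring.
(* A symmetric interval contains both 0 and [h] whatever the sign of [h]. *)
pose I := `[- `|h|, `|h|].
have gI := is_derive_has_derivative_on (I := [set` I]) (fun t _ => gD t).
have := @le_increment_dist R _ _ g g' (fun r => K * r) (cst K) 0 h gI phiD.
rewrite mulr0 !subr0 /g scale0r add0r !mxE; apply.
- by move=> z _; exact: f_bound.
- by rewrite /= in_itv/= oppr_le0 normr_ge0.
- by rewrite /= in_itv/= -ler_norml.
Qed.

(** The point moves from [y] to [x] by changing one coordinate at a time, each change costing at
    most [K] times the sup distance. Only partial derivatives along the axes enter, at the price of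
    the factor [d.+1]. *)
Lemma lipschitz_of_partials (x y : V) : `|f x - f y| <= d.+1%:R * K * `|x - y|.
Proof.
have K0 : 0 <= K by apply: le_trans (f_bound ord0 ord0 0).
pose p n : V := \row_i (if (i < n)%N then x ord0 i else y ord0 i).
have pS (n : 'I_d.+1) : p n.+1 = (x ord0 n - y ord0 n) *: delta_mx ord0 n + p n.
  apply/rowP => i; rewrite !mxE eqxx /=; case: (ltngtP i n) => [lt|gt|eq].
  - by rewrite ltnS ltnW// -val_eqE/= ltn_eqF// mulr0 add0r.
  - by rewrite ltnS leqNgt gt/= -val_eqE/= gtn_eqF// mulr0 add0r.
  - have -> : i = n by apply/val_inj.
    by rewrite ltnS leqnn eqxx mulr1 subrK.
have H n : (n <= d.+1)%N -> `|f (p n) - f y| <= n%:R * K * `|x - y|.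
  elim: n => [_|n IH nd].
    rewrite (_ : p 0%N = y) ?subrr ?normr0 ?mul0r//.
    by apply/rowP => i; rewrite mxE.
  apply: le_trans (ler_distD (f (p n)) _ _) _.
  rewrite -natr1 mulrDl mulrDl mul1r addrC lerD//; first exact: IH (ltnW nd).
  rewrite (pS (Ordinal nd)); apply: le_trans (line_lip _ _ _) _.
  rewrite ler_wpM2l//; apply: le_trans (coord_le_norm _ (Ordinal nd)).
  by rewrite !mxE.
have := H d.+1 (leqnn _); rewrite (_ : p d.+1 = x)//.
by apply/rowP => i; rewrite mxE ltn_ord.
Qed.

End LipschitzSlice.

(** * Lipschitz bound and group law of the flow *)

Section Flow.
Context {R : realType} {d : nat} (T : R) (A : 'rV[R]_d.+1 -> R -> 'rV[R]_d.+1) (LA : R).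
Local Notation V := 'rV[R]_d.+1.
Hypothesis T_gt0 : 0 < T.
Hypothesis A_C1 : C1_on_slab T A.
Hypothesis LA_gt0 : 0 < LA.
Hypothesis A_jac : (ereal_sup [set (operator_norm (spatial_jacobian A z.1 z.2))%:E |
  z in [set: 'rV[R]_d.+1] `*` `[0%R, T]] <= LA%:E)%E.

(** A Lipschitz constant of [A] in space for the sup norm: entries of the Jacobian are at most [LA],
    and the factor comes from [lipschitz_of_partials]. It is the k of the overview. *)
Definition flow_rate : R := d.+1%:R * LA.

Lemma flow_rate_gt0 : 0 < flow_rate.
Proof. by rewrite mulr_gt0. Qed.

Let I := `[0, T]%classic.

Lemma field_lipschitz t (x y : V) : I t -> `|A x t - A y t| <= flow_rate * `|x - y|.
Proof.
case: A_C1 => _ A_der _ It.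
apply: (@lipschitz_of_partials _ _ (A ^~ t)) => [i z|i j z]; first exact: (A_der i).1.
rewrite (_ : _ ord0 j = spatial_jacobian A z t i j); last by rewrite mxE.
apply: le_trans (entry_le_operator_norm _ _ _) _; rewrite -lee_fin.
by apply: le_trans A_jac; apply: ereal_sup_ubound; exists (z, t).
Qed.

Lemma flow_solution t1 (x : V) : I t1 ->
  ode_solution T A t1 x (fun t2 => flow T A t1 t2 x).
Proof.
move=> It1; case: A_C1 => A_cont _ _.
have [s sP] := picard T_gt0 flow_rate_gt0 field_lipschitz A_cont x It1.
exact: (@xgetI _ (cst x) (ode_solution T A t1 x) s sP).
Qed.

Lemma flow_lipschitz t1 t2 (x y : V) : I t1 -> I t2 ->
  `|flow T A t1 t2 x - flow T A t1 t2 y| <= expR (flow_rate * `|t2 - t1|) * `|x - y|.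
Proof.
move=> It1 It2; have [sx sD] := flow_solution x It1; have [rx rD] := flow_solution y It1.
have := gronwall flow_rate_gt0 field_lipschitz sD rD It1 It2.
by rewrite sx rx mulrC.
Qed.

Lemma flow_id t (x : V) : I t -> flow T A t t x = x.
Proof. by move=> It; have [] := flow_solution x It. Qed.

(** Both sides solve the same equation and agree at time [t2], so Gronwall with zero initial gap
    identifies them. *)
Lemma flow_comp t1 t2 t3 (x : V) : I t1 -> I t2 -> I t3 ->
  flow T A t2 t3 (flow T A t1 t2 x) = flow T A t1 t3 x.
Proof.
move=> It1 It2 It3; have [sx sD] := flow_solution x It1.
have [rx rD] := flow_solution (flow T A t1 t2 x) It2.
have := gronwall flow_rate_gt0 field_lipschitz rD sD It2 It3.
by rewrite rx subrr normr0 mul0r normr_le0 subr_eq0 => /eqP.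
Qed.

Lemma flowK t1 t2 : I t1 -> I t2 -> cancel (flow T A t1 t2) (flow T A t2 t1).
Proof. by move=> It1 It2 x; rewrite flow_comp// flow_id. Qed.

End Flow.
Arguments flow_rate {R} d LA.

(** * Lebesgue measurability *)

Section OuterMeasure.
Context {R : realType} {d : nat}.
Local Notation V := 'rV[R]_d.+1.
Local Notation mu := (lebesgue_outer_measure R d).
Implicit Types (X : set V) (F : nat -> V * V).

Lemma lebesgue_outer_le_cover X F : box_cover X F ->
  (mu X <= \sum_(k <oo) (box_volume (F k))%:E)%E.
Proof. by move=> XF; apply: ereal_inf_lbound; exists F. Qed.

Lemma box_volume_nonneg (b : V * V) :
  (forall i, b.1 ord0 i <= b.2 ord0 i) -> 0 <= box_volume b.
Proof. by move=> b12; apply: prodr_ge0 => i _; rewrite subr_ge0. Qed.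

Lemma lebesgue_outer_box (b : V * V) : (forall i, b.1 ord0 i <= b.2 ord0 i) ->
  (mu (open_box b) <= (box_volume b)%:E)%E.
Proof.
move=> b12; pose F n : V * V := if n is 0 then b else (0, 0).
have /lebesgue_outer_le_cover : box_cover (open_box b) F.
  split=> [[|n] i|x bx]; [exact: b12|by rewrite mxE|by exists 0%N].
rewrite (nneseries_split_cond 0%N 1%N)//; last first.
  by move=> n _; rewrite lee_fin box_volume_nonneg// => i; case: n => [|n]/=; rewrite ?mxE.
rewrite eseries0; last by case=> // n _ _; rewrite /box_volume big_ord_recl/= subrr mul0r.
by rewrite adde0 big_mkcond/= big_ltn// big_geq// adde0.
Qed.

(** Covers consist of open boxes, so the closed cube is enlarged by [e], and [e] then tends to 0
    along powers of 1/2. *)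
Lemma lebesgue_outer_cube X (c : V) (r : R) : 0 <= r ->
  (forall x, X x -> `|x - c| <= r) -> (mu X <= ((2 * r) ^+ d.+1)%:E)%E.
Proof.
move=> r0 Xc.
have H e : 0 < e -> (mu X <= ((2 * (r + e)) ^+ d.+1)%:E)%E.
  move=> e0; pose b : V * V := (c - const_mx (r + e), c + const_mx (r + e)).
  apply: (@le_trans _ _ (mu (open_box b))).
    apply: le_outer_measure => x /Xc xc i; rewrite !mxE.
    have := le_trans (coord_le_norm _ i) xc.
    by rewrite !mxE ler_norml => /andP[? ?]; apply/andP; split; lra.
  have /lebesgue_outer_box/le_trans : forall i, b.1 ord0 i <= b.2 ord0 i.
    by move=> i; rewrite !mxE; lra.
  apply; rewrite lee_fin /box_volume (eq_bigr (fun=> 2 * (r + e))).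
    by rewrite prodr_const card_ord.
  by move=> i _; rewrite !mxE; lra.
have mfin : mu X \is a fin_num.
  by rewrite ge0_fin_numE ?outer_measure_ge0// (le_lt_trans (H 1 ltr01)) ?ltry.
rewrite -(fineK mfin) lee_fin.
have Hl : (2 * (r + 1 * 2^-1 ^+ n)) ^+ d.+1 @[n --> \oo] --> (2 * (r + 0)) ^+ d.+1.
  apply: (@cvg_comp _ _ _ (fun n => 2 * (r + 1 * 2^-1 ^+ n)) (fun x => x ^+ d.+1));
    last exact: exprn_continuous.
  by apply: cvgMr; apply: cvgD; [exact: cvg_cst|exact: cvg_half_expn].
rewrite -[in leRHS](addr0 r); apply: (ler_cvg_to (cvg_cst _) Hl); apply: nearW => n.
by rewrite -lee_fin fineK// H// mul1r exprn_gt0.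
Qed.

(* The threshold is clamped to the edge so that both halves are genuine boxes. *)
Definition box_cut (i : 'I_d.+1) (c : R) (b : V * V) : R :=
  Num.max (b.1 ord0 i) (Num.min (b.2 ord0 i) c).

Definition box_below i c (b : V * V) : V * V :=
  (b.1, \row_j (if j == i then box_cut i c b else b.2 ord0 j)).
Definition box_above i c (b : V * V) : V * V :=
  (\row_j (if j == i then box_cut i c b else b.1 ord0 j), b.2).

Lemma box_volume_cut i c (b : V * V) :
  box_volume b = box_volume (box_below i c b) + box_volume (box_above i c b).
Proof.
rewrite /box_volume (bigD1 i)//= [X in _ = X + _](bigD1 i)//= [X in _ = _ + X](bigD1 i)//=.
rewrite !mxE eqxx; under [X in _ = _ * X + _]eq_bigr => j ji do rewrite mxE (negbTE ji).
under [X in _ = _ + _ * X]eq_bigr => j ji do rewrite mxE (negbTE ji).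
ring.
Qed.

Lemma box_cut_itv i c (b : V * V) : (forall i, b.1 ord0 i <= b.2 ord0 i) ->
  b.1 ord0 i <= box_cut i c b <= b.2 ord0 i.
Proof. by move=> b12; rewrite /box_cut le_max lexx/= ge_max b12 ge_min lexx. Qed.

Lemma hyperplane_null i (c : R) : mu [set x : V | x ord0 i = c] = 0%E.
Proof.
apply/eqP; rewrite eq_le outer_measure_ge0 andbT.
pose S N := [set x : V | x ord0 i = c] `&` [set x | forall j, - N%:R < x ord0 j < N%:R].
have S0 N : mu (S N) = 0%E.
  apply/eqP; rewrite eq_le outer_measure_ge0 andbT; apply/lee_addgt0Pr => e e0.
  rewrite add0e; pose P : R := (2 * N%:R) ^+ d.
  have P0 : 0 <= P by rewrite exprn_ge0 ?mulr_ge0.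
  (* Chosen so that the slab of thickness [2 * h] has volume [e * (P / (P + 1))], at most [e]; the
     [+ 1] handles [P = 0]. *)
  pose h := e / (2 * (P + 1)).
  have h0 : 0 < h by rewrite divr_gt0// mulr_gt0// ltr_wpDl.
  pose b : V * V := (\row_j (if j == i then c - h else - N%:R),
                     \row_j (if j == i then c + h else N%:R)).
  apply: (@le_trans _ _ (mu (open_box b))).
    apply: le_outer_measure => x /= [xc xN] j; rewrite !mxE.
    case: ifPn => [/eqP->|_]; last exact: xN.
    by rewrite xc; apply/andP; split; lra.
  apply: le_trans (lebesgue_outer_box _) _.
    by move=> j; rewrite !mxE; case: ifPn => _; [|have := ler0n R N]; lra.
  rewrite lee_fin /box_volume (bigD1 i)//= (eq_bigr (fun=> 2 * N%:R)); last first.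
    by move=> j ji; rewrite !mxE (negbTE ji); lra.
  rewrite prodr_const cardC1 card_ord /= -/P !mxE eqxx.
  rewrite (_ : c + h - (c - h) = 2 * h); last by ring.
  rewrite (_ : 2 * h * P = e * (P / (P + 1))); last first.
    by rewrite /h; field; rewrite gt_eqF// ltr_wpDl.
  by rewrite ler_piMr ?(ltW e0)// ler_pdivrMr ?ltr_wpDl// mul1r lerDl.
apply: (@le_trans _ _ (mu (\bigcup_N S N))).
  apply: le_outer_measure => x xc; exists (Num.truncn `|x|).+1 => //; split=> // j.
  have := le_lt_trans (coord_le_norm x j) (truncnS_gt _).
  by rewrite ltr_norml.
apply: le_trans (outer_measure_sigma_subadditive mu S) _.
by rewrite eseries0// => N _ _; rewrite S0.
Qed.

(** Every box of a cover is cut at [c], and the volumes of the two pieces add up. The open upper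
    pieces miss the points with [x ord0 i = c], but these form a null set. *)
Lemma halfspace_caratheodory i (c : R) :
  mu.-caratheodory [set x : V | x ord0 i < c].
Proof.
apply: le_caratheodory_measurable => X.
set H := [set x : V | x ord0 i < c].
apply: le_ereal_inf_tmp => _ [F [F12 XF] <-].
have Fl12 k j : (box_below i c (F k)).1 ord0 j <= (box_below i c (F k)).2 ord0 j.
  by rewrite /= mxE; case: ifPn => // /eqP->; have /andP[] := box_cut_itv i c (F12 k).
have Fr12 k j : (box_above i c (F k)).1 ord0 j <= (box_above i c (F k)).2 ord0 j.
  by rewrite /= mxE; case: ifPn => // /eqP->; have /andP[] := box_cut_itv i c (F12 k).
have Hl : (mu (X `&` H) <= \sum_(k <oo) (box_volume (box_below i c (F k)))%:E)%E.
  apply: lebesgue_outer_le_cover; split=> // x [/XF[k _ Fx] xc]; exists k => // j.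
  rewrite /= mxE; have := Fx j; case: ifPn => [/eqP->|//] /andP[-> xb] /=.
  by rewrite /box_cut lt_max lt_min xb xc orbT.
have Hr : (mu (X `&` ~` H) <= \sum_(k <oo) (box_volume (box_above i c (F k)))%:E)%E.
  have -> : X `&` ~` H = (X `&` [set x | c < x ord0 i]) `|`
      (X `&` [set x | x ord0 i = c]).
    rewrite -setIUr; congr (_ `&` _); apply/seteqP; split=> x /=.
      by move/negP; rewrite -leNgt le_eqVlt => /orP[/eqP->|]; [right|left].
    by rewrite /H/= => -[cx|->]; rewrite ?ltxx// ltNge (ltW cx).
  apply: le_trans (outer_measureU2 _ _ _) _.
  rewrite (_ : mu (X `&` [set x | x ord0 i = c]) = 0%E) ?adde0; last first.
    apply/eqP; rewrite eq_le outer_measure_ge0 andbT -(hyperplane_null i c).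
    by apply: le_outer_measure => x [].
  apply: lebesgue_outer_le_cover; split=> // x [/XF[k _ Fx] xc]; exists k => // j.
  rewrite /= mxE; have := Fx j; case: ifPn => [/eqP->|//] /andP[bx ->]; rewrite andbT.
  by rewrite /box_cut gt_max bx gt_min xc orbT.
apply: le_trans (leeD Hl Hr) _; rewrite -nneseriesD; last 2 first.
- by move=> k _ _; rewrite lee_fin box_volume_nonneg.
- by move=> k _ _; rewrite lee_fin box_volume_nonneg.
rewrite le_eqVlt; apply/orP; left; apply/eqP; apply: eq_eseriesr => k _.
by rewrite -EFinD -box_volume_cut.
Qed.

End OuterMeasure.

Section Measurability.
Context {R : realType} {d : nat}.
Local Notation V := 'rV[R]_d.+1.
Local Notation mu := (lebesgue_outer_measure R d).
Local Notation W := (caratheodory_type mu).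

Lemma null_measurable (X : set V) : mu X = 0%E -> measurable (X : set W).
Proof.
move=> X0; suff : mu.-caratheodory X by [].
apply: le_caratheodory_measurable => Y.
rewrite (_ : mu (Y `&` X) = 0%E) ?add0e; first by apply: le_outer_measure; exact: subIsetl.
apply/eqP; rewrite eq_le outer_measure_ge0 andbT -X0.
by apply: le_outer_measure; exact: subIsetr.
Qed.

Lemma measurable_open_box (b : V * V) : measurable (open_box b : set W).
Proof.
have -> : open_box b = \bigcap_(i in [set: 'I_d.+1])
    ([set x | x ord0 i < b.2 ord0 i] `\`
     ([set x | x ord0 i < b.1 ord0 i] `|` [set x | x ord0 i = b.1 ord0 i])).
  apply/seteqP; split=> x /=.
    move=> bx i _ /=; have /andP[bx1 bx2] := bx i; split=> //.
    by case=> [|e]; [rewrite ltNge (ltW bx1)|rewrite e ltxx in bx1].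
  move=> H i; have [/= -> nx] := H i Logic.I; rewrite andbT.
  rewrite lt_neqAle leNgt; apply/andP; split.
    by apply/eqP => e; apply: nx; right.
  by apply/negP => ?; apply: nx; left.
apply: (@fin_bigcap_measurable _ W) => [|i _]; first exact: finite_finset.
apply: measurableD.
  exact: halfspace_caratheodory.
apply: measurableU; first exact: halfspace_caratheodory.
exact/null_measurable/hyperplane_null.
Qed.

Lemma measurable_open (O : set V) : open O -> measurable (O : set W).
Proof.
move=> oO.
pose box (p : 'rV[rat]_d.+1 * 'rV[rat]_d.+1) : V * V := (map_mx ratr p.1, map_mx ratr p.2).
have -> : O = \bigcup_p (if pselect (open_box (box p) `<=` O) then open_box (box p) else set0).
  apply/seteqP; split=> x; last by case=> p _; case: pselect => // H /H.
  move=> Ox; have /nbhs_ballP[e /= e0 xeO] : nbhs x O by exact: open_nbhs_nbhs.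
  have /choice[p pP] i : exists q : rat * rat,
      [/\ x ord0 i - e < ratr q.1, ratr q.1 < x ord0 i,
          x ord0 i < ratr q.2 & ratr q.2 < x ord0 i + e].
    have [|q1] := @rat_in_itvoo R (x ord0 i - e) (x ord0 i); first by lra.
    have [|q2] := @rat_in_itvoo R (x ord0 i) (x ord0 i + e); first by lra.
    by rewrite !in_itv/= => /andP[? ?] /andP[? ?]; exists (q1, q2).
  exists (\row_i (p i).1, \row_i (p i).2) => //.
  case: pselect => [_ i|[]]; first by rewrite !mxE; have [_ -> ->] := pP i.
  move=> y Hy; apply: xeO; split=> // i j; rewrite (ord1 i).
  have := Hy j; rewrite !mxE => /andP[y1 y2]; have [? ? ? ?] := pP j.
  by rewrite -ball_normE/= ltr_distlC; apply/andP; split; lra.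
apply: (@countable_bigcupT_measurable _ W) => [|p]; first exact: countableP.
by case: pselect => H; [exact: measurable_open_box|exact: (@measurable0 _ W)].
Qed.

Lemma open_open_box (b : V * V) : open (open_box b).
Proof.
rewrite openE => x bx.
have : \forall y \near x, forall i : 'I_d.+1,
    b.1 ord0 i < (y : V) ord0 i < b.2 ord0 i.
  apply: (@filter_forall V _ (fun i (y : V) => b.1 ord0 i < y ord0 i < b.2 ord0 i) (nbhs x)) => i.
  have ci : (fun M : V => M ord0 i) M @[M --> x] --> x ord0 i by exact: coord_continuous.
  have : x ord0 i \in `]b.1 ord0 i, b.2 ord0 i[ by rewrite in_itv/=; exact: bx.
  move=> /near_in_itvoo H.
  have {}H : \forall y \near x, (y : V) ord0 i \in `]b.1 ord0 i, b.2 ord0 i[ by exact: ci _ H.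
  by apply: filterS H => y; rewrite in_itv.
by [].
Qed.

Lemma lebesgue_outer_regular (X : set V) (e : R) : (mu X < +oo)%E -> 0 < e ->
  exists O : set V, [/\ open O, X `<=` O & (mu O <= mu X + e%:E)%E].
Proof.
move=> Xoo e0; have Xfin : mu X \is a fin_num by rewrite ge0_fin_numE ?outer_measure_ge0.
have [_ [F XF <-] Fe] := lb_ereal_inf_adherent e0 Xfin.
exists (\bigcup_k open_box (F k)); split.
- by apply: bigcup_open => k _; exact: open_open_box.
- by case: XF.
- by apply: le_trans (ltW Fe); apply: lebesgue_outer_le_cover; split=> //; case: XF.
Qed.

Lemma lebesgue_bounded_lty (X : set V) (r : R) :
  (forall x, X x -> `|x| <= r) -> (mu X < +oo)%E.
Proof.
move=> Xr; have [[x Xx]|X0] := pselect (X !=set0); last first.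
  rewrite (_ : X = set0) ?outer_measure0//.
  by apply/seteqP; split=> // x Xx; case: X0; exists x.
have r0 : 0 <= r by apply: le_trans (Xr x Xx).
apply: le_lt_trans (lebesgue_outer_cube (c := 0) r0 _) (ltry _).
by move=> y /Xr; rewrite subr0.
Qed.

(* A measurable set of finite measure is a countable intersection of open
   sets minus a null set, and both kinds have measurable preimages. *)
Lemma measurable_fun_null_preimage (f : V -> V) : continuous f ->
  (forall X, mu X = 0%E -> mu (f @^-1` X) = 0%E) ->
  measurable_fun [set: W] (f : W -> W).
Proof.
move=> fc f0.
have fin (E : set V) : measurable (E : set W) -> (mu E < +oo)%E ->
    measurable (f @^-1` E : set W).
  move=> mE Eoo.
  have /choice[U OP] n : exists O : set V,
      [/\ open O, E `<=` O & (mu O <= mu E + (n.+1%:R^-1)%:E)%E].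
    by apply: lebesgue_outer_regular => //; rewrite invr_gt0.
  pose G := \bigcap_n U n.
  have EG : E `<=` G by move=> x Ex n _; have [_ + _] := OP n; exact.
  have mG : measurable (G : set W).
    by apply: (@bigcapT_measurable _ W) => n; apply: measurable_open; have [] := OP n.
  have GE0 : mu (G `\` E) = 0%E.
    apply/eqP; rewrite eq_le outer_measure_ge0 andbT.
    apply/lee_addgt0Pr => e e0; rewrite add0e.
    have [_ EO OE] := OP (Num.truncn e^-1).
    apply: (@le_trans _ _ (mu (U (Num.truncn e^-1) `&` ~` E))).
      by apply: le_outer_measure => x [Gx nE]; split=> //; exact: Gx.
    apply: (@le_trans _ _ ((Num.truncn e^-1).+1%:R^-1)%:E); last first.
      by rewrite lee_fin invf_ple ?posrE// ltW// truncnS_gt.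
    (* Caratheodory's condition for [E] splits the measure of the open set; the finite measure of
       [E] then cancels. *)
    move: OE; rewrite (mE (U _)) (setIidr EO) leeD2lE//.
    by rewrite ge0_fin_numE ?outer_measure_ge0.
  have -> : f @^-1` E = (\bigcap_n f @^-1` U n) `\` f @^-1` (G `\` E).
    apply/seteqP; split=> x /=.
      by move=> Efx; split=> [n _|[]//]; exact: EG.
    by move=> [Gx H]; apply: contrapT => nE; apply: H.
  apply: measurableD; last exact/null_measurable/f0.
  apply: (@bigcapT_measurable _ W) => n; apply: measurable_open.
  by apply: open_comp => [x _|]; [exact: fc|have [] := OP n].
move=> _ E mE; rewrite setTI.
(* The sets [E] cut by these boxes are bounded, hence of finite measure, and exhaust [E]. *)
pose B n : V * V := (const_mx (- n%:R), const_mx n%:R).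
have -> : f @^-1` E = \bigcup_n f @^-1` (E `&` open_box (B n)).
  apply/seteqP; split=> x /=; last by case=> n _ [].
  move=> Efx; exists (Num.truncn `|f x|).+1 => //; split=> // j; rewrite !mxE.
  have := le_lt_trans (coord_le_norm (f x) j) (truncnS_gt _).
  by rewrite ltr_norml.
apply: bigcupT_measurable => n; apply: fin.
  by apply: measurableI => //; exact: measurable_open_box.
apply: (@lebesgue_bounded_lty _ n%:R) => x [_ Bx]; apply: row_norm_le => // i.
by have := Bx i; rewrite !mxE => /andP[? ?]; rewrite ler_norml !ltW.
Qed.

End Measurability.

(** * Images under Lipschitz maps *)

Lemma outer_measure_fin_bigcup (T : Type) (R : realType)
    (mu : {outer_measure set T -> \bar R}) (J : finType) (S : J -> set T) (c : R) :
  (forall j, (mu (S j) <= c%:E)%E) -> (mu (\bigcup_j S j) <= (#|J|%:R * c)%:E)%E.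
Proof.
move=> Sc.
pose F n := if insub n is Some i then S (enum_val (i : 'I_#|J|)) else set0.
apply: (@le_trans _ _ (mu (\big[setU/set0]_(i < #|J|) F i))).
  apply: le_outer_measure => x [j _ Sx]; rewrite -bigcup_mkord.
  exists (enum_rank j) => /=; first exact: ltn_ord.
  by rewrite /F insubT//= => ?; rewrite (_ : Sub _ _ = enum_rank j) ?enum_rankK//; apply/val_inj.
apply: le_trans (outer_measure_subadditive _ _ _) _.
apply: (@le_trans _ _ (\sum_(i < #|J|) c%:E)%E).
  by apply: lee_sum => i _; rewrite /F insubT.
by rewrite sumEFin sumr_const card_ord lee_fin mulr_natl.
Qed.

Section LipschitzMeasure.
Context {R : realType} {d : nat}.
Local Notation V := 'rV[R]_d.+1.
Local Notation mu := (lebesgue_outer_measure R d).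
Variables (f : V -> V) (K : R).
Hypothesis K_gt0 : 0 < K.
Hypothesis f_lip : forall x y, `|f x - f y| <= K * `|x - y|.

(** The box is covered by a grid of cubes of side [h], each sent into a cube of side [K * h]. Along
    axis [i] there are [m i] cells, the last one possibly incomplete, which produces the extra [+ h]
    in each factor. *)
Let image_box_grid (b : V * V) (h : R) : 0 < h ->
  (forall i, b.1 ord0 i <= b.2 ord0 i) ->
  (mu (f @` open_box b) <= (K ^+ d.+1 * \prod_(i < d.+1) (b.2 ord0 i - b.1 ord0 i + h))%:E)%E.
Proof.
move=> h0 b12.
pose l i := b.2 ord0 i - b.1 ord0 i.
pose m i := (Num.truncn (l i / h)).+1.
(* A cell is a choice of index on each axis; the function type is dependent because the number of
   cells varies with the axis. *)
pose J : finType := {dffun forall i : 'I_d.+1, 'I_(m i)}.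
pose c (j : J) : V := \row_i (b.1 ord0 i + (j i)%:R * h + h / 2).
pose S (j : J) := f @` [set x | `|x - c j| <= h / 2].
have l0 i : 0 <= l i by rewrite subr_ge0.
have Sj j : (mu (S j) <= ((K * h) ^+ d.+1)%:E)%E.
  rewrite (_ : K * h = 2 * (K * (h / 2))); last by field.
  apply: (@lebesgue_outer_cube _ _ _ (f (c j))); first by rewrite !mulr_ge0 ?invr_ge0 ?ltW.
  move=> _ [x /= xc <-]; apply: le_trans (f_lip _ _) _.
  by rewrite ler_wpM2l// ltW.
apply: (@le_trans _ _ (mu (\bigcup_j S j))).
  apply: le_outer_measure => _ [x bx <-].
  have km i : (Num.truncn ((x ord0 i - b.1 ord0 i) / h) < m i)%N.
    have /andP[x1 x2] := bx i.
    by rewrite ltnS le_truncn// ler_wpM2r ?invr_ge0 ?(ltW h0)// lerD2r ltW.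
  exists (finfun (fun i => Ordinal (km i)) : J) => //; exists x => //=.
  apply: row_norm_le => [|i]; first by rewrite divr_ge0// ltW.
  have /andP[x1 x2] := bx i.
  have q0 : 0 <= (x ord0 i - b.1 ord0 i) / h by rewrite divr_ge0 ?ltW// subr_gt0.
  have /andP[] := truncn_itv q0; set k := Num.truncn _.
  rewrite ler_pdivlMr// ltr_pdivrMr// -(natr1 k) => ? ?.
  rewrite !mxE ffunE /= -/k.
  by rewrite ler_norml; apply/andP; split; lra.
apply: le_trans (outer_measure_fin_bigcup Sj) _; rewrite lee_fin.
rewrite card_dep_ffun.
have -> : (foldr muln 1 [seq #|'I_(m x)| | x : 'I_d.+1] = \prod_(i < d.+1) m i)%N.
  rewrite /image_mem -[RHS]big_enum; elim: (enum _) => [|i s IH] /=; first by rewrite big_nil.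
  by rewrite big_cons card_ord IH.
rewrite natr_prod exprMn mulrCA ler_wpM2l ?exprn_ge0 ?(ltW K_gt0)//.
rewrite -[X in _ ^+ X]card_ord -prodr_const -big_split/=. apply: ler_prod => i _.
rewrite mulr_ge0 ?(ltW h0)//= /m -natr1 mulrDl mul1r lerD2r.
by have /andP[+ _] := truncn_itv (divr_ge0 (l0 i) (ltW h0)); rewrite ler_pdivlMr.
Qed.

Let image_box (b : V * V) : (forall i, b.1 ord0 i <= b.2 ord0 i) ->
  (mu (f @` open_box b) <= (K ^+ d.+1 * box_volume b)%:E)%E.
Proof.
move=> b12.
have mfin : mu (f @` open_box b) \is a fin_num.
  by rewrite ge0_fin_numE ?outer_measure_ge0// (le_lt_trans (image_box_grid ltr01 b12)) ?ltry.
rewrite -(fineK mfin) lee_fin.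
have Hl : K ^+ d.+1 * \prod_(i < d.+1) (b.2 ord0 i - b.1 ord0 i + 1 * 2^-1 ^+ n)
    @[n --> \oo] --> K ^+ d.+1 * \prod_(i < d.+1) (b.2 ord0 i - b.1 ord0 i + 0).
  apply: cvgMr; apply: cvg_big => [|i _]; first exact: mul_continuous.
  by apply: cvgD; [exact: cvg_cst|exact: cvg_half_expn].
rewrite /box_volume; under eq_bigr do rewrite -[_ - _]addr0.
apply: (ler_cvg_to (cvg_cst _) Hl); apply: nearW => n.
by rewrite -lee_fin fineK// image_box_grid// mul1r exprn_gt0.
Qed.

Lemma lipschitz_lebesgue_outer (X : set V) :
  (mu (f @` X) <= (K ^+ d.+1)%:E * mu X)%E.
Proof.
have Kd : 0 < K ^+ d.+1 by rewrite exprn_gt0.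
rewrite -lee_pdivrMl//; apply: le_ereal_inf_tmp => _ [F [F12 XF] <-].
rewrite lee_pdivrMl// -nneseriesZl; last by move=> k _; rewrite lee_fin box_volume_nonneg.
apply: (@le_trans _ _ (\sum_(k <oo) mu (f @` open_box (F k)))%E).
  apply: le_trans (outer_measure_sigma_subadditive mu _).
  apply: le_outer_measure => _ [x Xx <-].
  by have [k _ Fx] := XF x Xx; exists k => //; exists x.
apply: lee_nneseries => k _; first by rewrite outer_measure_ge0.
by rewrite -EFinM; exact: image_box.
Qed.

End LipschitzMeasure.

(** * Densities *)

Section Density.
Local Open Scope ereal_scope.
Context {dis : measure_display} {T : measurableType dis} {R : realType}.

(** Restricting both measures to [D] makes them finite, so that Radon-Nikodym applies; its
    derivative is finite everywhere and can be taken real-valued. *)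
Lemma density_exists (m l : {measure set T -> \bar R}) (D : set T) :
  measurable D -> m D < +oo -> l D < +oo ->
  (forall E, measurable E -> E `<=` D -> l E = 0 -> m E = 0) ->
  exists G : T -> R, [/\ measurable_fun setT G, forall x, (0 <= G x)%R &
    forall h : T -> \bar R, (forall x, 0 <= h x) -> measurable_fun D h ->
      \int[m]_(x in D) h x = \int[l]_(x in D) (h x * (G x)%:E)].
Proof.
move=> mD mfin lfin lm.
pose m0 : {finite_measure set T -> \bar R} := mfrestr mD mfin.
pose l0 : {finite_measure set T -> \bar R} := mfrestr mD lfin.
have m0E A : m0 A = m (A `&` D) by [].
have l0E A : l0 A = l (A `&` D) by [].
have m0l0 : m0 `<< l0.
  apply/null_content_dominatesP => E mE; rewrite /= /mfrestr /mrestr; apply: lm => //.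
  exact: measurableI.
pose g := Radon_Nikodym_SigmaFinite.f m0 l0.
have gint := Radon_Nikodym_SigmaFinite.f_integrable m0l0.
have gE x : (fine (g x))%:E = g x.
  by rewrite fineK// Radon_Nikodym_SigmaFinite.f_fin_num.
exists (fine \o g); split.
- by apply: measurableT_comp => //; have /integrableP[] := gint.
- by move=> x; apply: fine_ge0; exact: Radon_Nikodym_SigmaFinite.f_ge0.
move=> h h0 mh; rewrite (@eq_measure_integral _ _ _ D m0); last first.
  by move=> A mA AD; rewrite -[in LHS](setIidl AD); exact: (esym (m0E A)).
rewrite -(Radon_Nikodym_SigmaFinite.change_of_variables m0l0)//.
rewrite (@eq_measure_integral _ _ _ D l l0); last first.
  by move=> A mA AD; rewrite -[in RHS](setIidl AD); exact: (l0E A).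
by apply: eq_integral => x _ /=; rewrite gE.
Qed.

(** On the set where [g < f], the hypothesis and this strict inequality force equal integrals over
    every measurable subset. Hence [f = g] almost everywhere there, and the set is null. *)
Lemma le_of_integrals_ae (l : {measure set T -> \bar R}) (D : set T) (f g : T -> R) :
  measurable D -> measurable_fun setT f -> measurable_fun setT g ->
  (forall x, 0 <= f x)%R -> (forall x, 0 <= g x)%R ->
  \int[l]_(x in D) (g x)%:E < +oo ->
  (forall E, measurable E -> E `<=` D ->
     \int[l]_(x in E) (f x)%:E <= \int[l]_(x in E) (g x)%:E) ->
  {ae l, forall x, D x -> (f x <= g x)%R}.
Proof.
move=> mD mf mg f0 g0 gfin fg.
pose E := D `&` [set x | (g x < f x)%R].
have mE : measurable E.
  have ltm : measurable_fun D (fun x => (g x < f x)%R).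
    by apply: measurable_fun_ltr; [exact: measurable_funS mg|exact: measurable_funS mf].
  exact: (ltm mD [set true]).
have mef (B : set T) : measurable_fun B (EFin \o f).
  by apply/measurable_EFinP; exact: measurable_funS mf.
have meg (B : set T) : measurable_fun B (EFin \o g).
  by apply/measurable_EFinP; exact: measurable_funS mg.
have gint : l.-integrable E (EFin \o g).
  apply/integrableP; split=> //; apply: le_lt_trans gfin.
  under eq_integral => x _ do rewrite /= ger0_norm//.
  by apply: ge0_subset_integral => // [x _|x [] //]; rewrite lee_fin.
have := @integral_ae_eq _ _ _ l E mE (EFin \o f) (EFin \o g) gint (mef E).
case=> [A AE mA|N [mN N0 sN]].
  apply/eqP; rewrite eq_le fg// ?andbT; last by move=> x /AE[].
  by apply: ge0_le_integral => // x /AE[_ /ltW]; rewrite lee_fin.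
exists N; split=> // x /= /not_implyP[Dx /negP]; rewrite -ltNge => gf.
by apply: sN => /= H; have := H (conj Dx gf); case=> e; rewrite e ltxx in gf.
Qed.

(** Multiplication by the nonnegative [G] commutes with positive and negative parts, so the formula
    for nonnegative functions applies to each part. *)
Lemma integral_change_of_variables_signed (T' : measurableType dis)
  (l : {measure set T -> \bar R}) (l' : {measure set T' -> \bar R})
  (D : set T) (D' : set T') (f : T' -> T) (G : T' -> R) :
  (forall x, 0 <= G x)%R ->
  (forall h : T -> \bar R, (forall x, 0 <= h x) -> measurable_fun setT h ->
     \int[l]_(x in D) h x = \int[l']_(y in D') (h (f y) * (G y)%:E)) ->
  forall h : T -> R, measurable_fun setT h ->
    \int[l]_(x in D) (h x)%:E = \int[l']_(y in D') (h (f y) * G y)%:E.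
Proof.
move=> G0 H h mh; have meh : measurable_fun setT (EFin \o h) by exact/measurable_EFinP.
rewrite integralE [RHS]integralE; congr (_ - _).
- rewrite H//; last exact: measurable_funepos.
  apply: eq_integral => y _; rewrite !funeposE/= -!EFin_max -EFinM.
  by rewrite maxr_pMl// mul0r.
- rewrite H//; last exact: measurable_funeneg.
  apply: eq_integral => y _; rewrite !funenegE/= -!EFin_max -EFinM.
  by rewrite maxr_pMl// mul0r mulNr.
Qed.

End Density.

(** * Transport by the flow *)

Section Transport.
Context {R : realType} {d : nat} (T : R) (A : 'rV[R]_d.+1 -> R -> 'rV[R]_d.+1) (LA : R).
Local Notation V := 'rV[R]_d.+1.
Local Notation mu := (lebesgue_outer_measure R d).
Local Notation W := (caratheodory_type mu).
Local Notation lam := (@lebesgueV R d).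
Hypothesis T_gt0 : 0 < T.
Hypothesis A_C1 : C1_on_slab T A.
Hypothesis LA_gt0 : 0 < LA.
Hypothesis A_jac : (ereal_sup [set (operator_norm (spatial_jacobian A z.1 z.2))%:E |
  z in [set: 'rV[R]_d.+1] `*` `[0%R, T]] <= LA%:E)%E.
Variable Omega : set V.
Hypothesis Omega_open : open Omega.
Hypothesis Omega_bounded : bounded_set Omega.

Local Notation I := `[0, T]%classic.
Local Notation Phi := (flow T A).
Local Notation D t := (moving_domain T A Omega t).

Let I0 : I 0. Proof. by rewrite /= in_itv/= lexx ltW. Qed.
Let IT : I T. Proof. by rewrite /= in_itv/= lexx ltW. Qed.

Let PhiK s t : I s -> I t -> cancel (Phi s t) (Phi t s).
Proof. exact: (flowK T_gt0 A_C1 LA_gt0 A_jac). Qed.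

Let Phi_comp r s t x : I r -> I s -> I t -> Phi s t (Phi r s x) = Phi r t x.
Proof. exact: (flow_comp T_gt0 A_C1 LA_gt0 A_jac). Qed.

Let Phi_id t x : I t -> Phi t t x = x.
Proof. exact: (flow_id T_gt0 A_C1 LA_gt0 A_jac). Qed.

(** An image becomes a preimage under the inverse flow, from which openness, and thus measurability,
    follows by continuity. *)
Lemma moving_domainE t : I t -> D t = Phi t T @^-1` Omega.
Proof.
move=> It; apply/seteqP; split=> [_ [y Oy <-]|x /= Ox]; first by rewrite /= PhiK.
by exists (Phi t T x) => //; rewrite PhiK.
Qed.

Lemma moving_domain_flow s t (x : V) : I s -> I t -> D t (Phi s t x) = D s x.
Proof. by move=> Is It; rewrite !moving_domainE//= Phi_comp. Qed.

(** The Gronwall Lipschitz constant of the flow from [s] to [t], raised to the dimension. *)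
Definition volume_growth (s t : R) : R := expR (flow_rate d LA * `|t - s|) ^+ d.+1.

Lemma volume_growth_gt0 s t : 0 < volume_growth s t.
Proof. by rewrite exprn_gt0// expR_gt0. Qed.

Lemma lebesgue_outer_flow s t (X : set V) : I s -> I t ->
  (mu (Phi s t @` X) <= (volume_growth s t)%:E * mu X)%E.
Proof.
move=> Is It; apply: lipschitz_lebesgue_outer; first exact: expR_gt0.
by move=> x y; exact: (flow_lipschitz T_gt0 A_C1 LA_gt0 A_jac).
Qed.

Lemma preimage_flow s t (X : set V) : I s -> I t -> Phi s t @^-1` X = Phi t s @` X.
Proof.
move=> Is It; apply/seteqP; split=> [x /= Xx|_ [y Xy <-]]; last by rewrite /= PhiK.
by exists (Phi s t x) => //; rewrite PhiK.
Qed.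

(** The preimage is the image under the inverse flow, which is Lipschitz as well. *)
Lemma lebesgue_outer_flow_null s t (X : set V) : I s -> I t ->
  mu X = 0%E -> mu (Phi s t @^-1` X) = 0%E.
Proof.
move=> Is It X0; apply/eqP; rewrite eq_le outer_measure_ge0 andbT preimage_flow//.
by apply: le_trans (lebesgue_outer_flow _ _ _) _ => //; rewrite X0 mule0.
Qed.

Lemma flow_continuous s t : I s -> I t -> continuous (Phi s t).
Proof.
move=> Is It; suff H (x : V) : Phi s t y @[y --> x] --> Phi s t x by [].
apply/(@cvgrPdist_le _ _ _ (nbhs x)) => e e0.
pose K := expR (flow_rate d LA * `|t - s|).
have K0 : 0 < K by exact: expR_gt0.
apply/nbhs_ballP; exists (e / K) => [|y]; first exact: divr_gt0.
rewrite -ball_normE/= => /ltW; rewrite ler_pdivlMr// mulrC.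
exact/le_trans/(flow_lipschitz T_gt0 A_C1 LA_gt0 A_jac).
Qed.

Lemma flow_measurable s t : I s -> I t ->
  measurable_fun [set: W] (Phi s t : W -> W).
Proof.
move=> Is It; apply: measurable_fun_null_preimage; first exact: flow_continuous.
by move=> X; exact: lebesgue_outer_flow_null.
Qed.

Lemma measurable_moving_domain t : I t -> measurable (D t : set W).
Proof.
move=> It; apply: measurable_open; rewrite moving_domainE//.
by apply: open_comp => // x _; exact: flow_continuous.
Qed.

Lemma moving_domain_lty t : I t -> (mu (D t) < +oo)%E.
Proof.
move=> It; apply: le_lt_trans (lebesgue_outer_flow _ IT It) _.
apply: lte_mul_pinfty => //; first by rewrite lee_fin ltW ?volume_growth_gt0.
have [M [_ HM]] := Omega_bounded.
by apply: (@lebesgue_bounded_lty _ _ _ (M + 1)) => x; apply: HM; rewrite ltrDl.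
Qed.

(* [G] plays the role of the Jacobian determinant of the flow from time 0 to t. *)
Definition is_volume_density (t : R) (G : W -> R) :=
  [/\ measurable_fun setT G, forall y, 0 <= G y &
    forall h : W -> \bar R, (forall x, 0 <= h x)%E -> measurable_fun setT h ->
     (\int[lam]_(x in D t) h x = \int[lam]_(y in D 0) (h (Phi 0 t y) * (G y)%:E))%E].

(** A density is determined only almost everywhere. At time 0 it is pinned to the constant 1, so
    that the initial condition holds pointwise and time 0 can serve as reference. *)
Lemma volume_density_exists t : I t -> exists2 G, is_volume_density t G & (t = 0 -> G = cst 1).
Proof.
move=> It; have [t0|t0] := eqVneq t 0.
  exists (cst 1) => //; split=> // h h0 mh; rewrite t0.
  by apply: eq_integral => x _; rewrite Phi_id// mule1.
pose g : W -> W := Phi t 0.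
have mg : measurable_fun setT g by exact: flow_measurable.
have [m mE] : exists m : {measure set W -> \bar R}, forall E, m E = pushforward lam g E.
  by unshelve eexists (measure_function_pushforward__canonical__measure_function_Measure lam mg).
have gD : g @^-1` D 0 = D t.
  by apply/seteqP; split=> x; rewrite /g /= moving_domain_flow.
have [||||G [mG G0 GP]] := @density_exists _ W _ m lam (D 0).
- exact: measurable_moving_domain.
- by rewrite mE /pushforward gD; exact: moving_domain_lty.
- exact: moving_domain_lty.
- by move=> E _ _ E0; rewrite mE; exact: lebesgue_outer_flow_null.
exists G; last by move=> te; rewrite te eqxx in t0.
split=> // h h0 mh.
have mhPhi : measurable_fun [set: W] (h \o (Phi 0 t : W -> W)).
  by apply: measurableT_comp => //; exact: flow_measurable.
rewrite -GP//; last by apply: measurable_funS mhPhi.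
rewrite (@eq_measure_integral _ _ _ _ (pushforward lam g) m); last by move=> E _ _; exact: mE.
rewrite ge0_integral_pushforward//; last 2 first.
- exact: measurable_moving_domain.
- exact: measurable_funS mhPhi.
by rewrite gD; apply: eq_integral => x _ /=; rewrite PhiK.
Qed.

(** Over [E] the densities integrate to the volumes of the images of [E] at times [s] and [t]. The
    first image is obtained from the second by the flow from [t] to [s], whose volume growth is
    bounded. *)
Lemma volume_density_le s t Gs Gt : I s -> I t ->
  is_volume_density s Gs -> is_volume_density t Gt ->
  {ae lam, forall y, D 0 y -> Gs y <= volume_growth t s * Gt y}.
Proof.
move=> Is It [mGs Gs0 HGs] [mGt Gt0 HGt].
have c0 := volume_growth_gt0 t s.
have dens r G (E : set W) : I r -> is_volume_density r G -> measurable E -> E `<=` D 0 ->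
    (\int[lam]_(y in E) (G y)%:E = mu (Phi 0 r @` E))%E.
  move=> Ir [mG G0 HG] mE ED.
  have mf : measurable (Phi 0 r @` E : set W).
    by rewrite -preimage_flow// -[X in measurable X]setTI; exact: flow_measurable.
  (* Testing the density formula on the indicator of the image turns its left side into a volume. *)
  pose h : W -> \bar R := EFin \o \1_(Phi 0 r @` E : set W).
  have h0 x : (0 <= h x)%E by rewrite lee_fin.
  have mh : measurable_fun setT h by apply/measurable_EFinP; exact: measurable_indic.
  have := HG h h0 mh; rewrite integral_indic//; last exact: measurable_moving_domain.
  rewrite setIidl; last by move=> _ [y /ED Dy <-]; rewrite moving_domain_flow.
  move=> ->.
  rewrite integral_mkcond [RHS]integral_mkcond; apply: eq_integral => y _.
  rewrite /patch; have [yE|yE] := boolP (y \in E).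
    rewrite mem_set; last by apply: ED; exact: set_mem.
    rewrite /h /= indicE mem_set ?mul1e//; exists y => //; exact: set_mem.
  case: ifPn => // yD; rewrite /h /= indicE memNset ?mul0e//.
  move=> [z Ez /(congr1 (Phi r 0))]; rewrite !PhiK// => zy.
  by move/negP: yE; apply; rewrite -zy mem_set.
apply: (@le_of_integrals_ae _ W _ lam (D 0) Gs (fun y => volume_growth t s * Gt y)) => //.
- exact: measurable_moving_domain.
- exact: measurable_funM.
- by move=> x; rewrite mulr_ge0// ltW.
- under eq_integral do rewrite EFinM.
  rewrite ge0_integralZl//; last 4 first.
  + exact: measurable_moving_domain.
  + exact/measurable_EFinP/(measurable_funS _ _ mGt).
  + by move=> x _; rewrite lee_fin.
  + by rewrite lee_fin ltW.
  rewrite (dens t) //; last exact: measurable_moving_domain.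
  apply: lte_mul_pinfty => //; first by rewrite lee_fin ltW.
  apply: le_lt_trans (lebesgue_outer_flow _ I0 It) _.
  apply: lte_mul_pinfty => //; first by rewrite lee_fin ltW ?volume_growth_gt0.
  exact: moving_domain_lty.
move=> E mE ED.
under [leRHS]eq_integral do rewrite EFinM.
rewrite ge0_integralZl//; last 3 first.
+ exact/measurable_EFinP/(measurable_funS _ _ mGt).
+ by move=> x _; rewrite lee_fin.
+ by rewrite lee_fin ltW.
rewrite (dens t Gt)// (dens s Gs)//; apply: le_trans (lebesgue_outer_flow _ It Is).
rewrite le_eqVlt; apply/orP; left; apply/eqP; congr (mu _).
apply/seteqP; split=> [_ [y Ey <-]|_ [_ [y Ey <-] <-]].
  by exists (Phi 0 t y); [exists y|rewrite Phi_comp].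
by exists y; rewrite ?Phi_comp.
Qed.

End Transport.
Arguments volume_growth {R} d LA s t.
Arguments volume_growth_gt0 {R} d LA s t.

(** * The solution *)

Section L2Norm.
Context {R : realType} {d : nat}.
Local Notation V := 'rV[R]_d.+1.
Local Notation W := (caratheodory_type (lebesgue_outer_measure R d)).
Local Notation lam := (@lebesgueV R d).

Lemma L2_normE (D : set V) (f : V -> R) : measurable (D : set W) ->
  L2_norm D f = ((\int[lam]_(x in D) ((f x) ^+ 2)%:E) `^ 2^-1)%E.
Proof.
move=> mD; rewrite /L2_norm unlock; congr poweR.
rewrite [RHS]integral_mkcond; apply: eq_integral => x _ /=.
rewrite /patch; case: ifPn => _ /=.
  by rewrite powR_mulrn// real_normK ?num_real.
by rewrite powR_mulrn// normr0 expr0n.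
Qed.

Lemma L2P (D : set V) (f : V -> R) : measurable (D : set W) ->
  L2 D f <-> measurable_fun [set: W] (f \_ D : W -> R) /\
             (\int[lam]_(x in D) ((f x) ^+ 2)%:E < +oo)%E.
Proof.
move=> mD; have finE : (f \_ D \in finLfun lam 2%:E) <-> (L2_norm D f < +oo)%E.
  by split=> [/set_mem|?] //; exact: mem_set.
have mfE : (f \_ D \in @mfun _ _ W R) <-> measurable_fun [set: W] (f \_ D : W -> R).
  by split=> [/set_mem|?] //; exact: mem_set.
rewrite L2_normE// in finE; split=> [/andP[/mfE mf /finE fin]|[mf fin]].
  by split=> //; apply: lty_poweRy fin; rewrite invr_eq0.
by apply/andP; split; [exact/mfE|exact/finE/poweR_lty].
Qed.

End L2Norm.

Lemma measurable_funV (R : realType) (dis : measure_display) (T : measurableType dis)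
  (f : T -> R) : (forall x, 0 <= f x) -> measurable_fun setT f ->
  measurable_fun setT (fun x => (f x)^-1).
Proof.
(* On nonnegative reals inversion is the power -1, also at 0, where both conventions give 0. *)
move=> f0 mf; rewrite (_ : (fun x => _) = (@powR R)^~ (-1) \o f).
  by apply: measurableT_comp => //; exact: measurable_powR.
by apply/funext => x /=; rewrite powR_inv1.
Qed.

Section Existence.
Context {R : realType} {d : nat} (T : R) (A : 'rV[R]_d.+1 -> R -> 'rV[R]_d.+1) (LA : R).
Local Notation V := 'rV[R]_d.+1.
Local Notation mu := (lebesgue_outer_measure R d).
Local Notation W := (caratheodory_type mu).
Local Notation lam := (@lebesgueV R d).
Hypothesis T_gt0 : 0 < T.
Hypothesis A_C1 : C1_on_slab T A.
Hypothesis LA_gt0 : 0 < LA.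
Hypothesis A_jac : (ereal_sup [set (operator_norm (spatial_jacobian A z.1 z.2))%:E |
  z in [set: 'rV[R]_d.+1] `*` `[0%R, T]] <= LA%:E)%E.
Variable Omega : set V.
Hypothesis Omega_open : open Omega.
Hypothesis Omega_bounded : bounded_set Omega.
Variable U0 : V -> R.
Hypothesis U0_L2 : L2 (moving_domain T A Omega 0) U0.

Local Notation I := `[0, T]%classic.
Local Notation Phi := (flow T A).
Local Notation D t := (moving_domain T A Omega t).

Let I0 : I 0. Proof. by rewrite /= in_itv/= lexx ltW. Qed.
Let IT : I T. Proof. by rewrite /= in_itv/= lexx ltW. Qed.
Let mD t (It : I t) : measurable (D t : set W) :=
  measurable_moving_domain T_gt0 A_C1 LA_gt0 A_jac Omega_open It.
Let mPhi s t (Is : I s) (It : I t) : measurable_fun [set: W] (Phi s t : W -> W) :=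
  flow_measurable T_gt0 A_C1 LA_gt0 A_jac Is It.

Variable G : R -> W -> R.
Hypothesis G_density : forall t, I t -> is_volume_density T A Omega t (G t).
Hypothesis G_init : G 0 = cst 1.

Let u : V -> R := U0 \_ (D 0).

Let measurable_u : measurable_fun [set: W] (u : W -> R).
Proof. by have /L2P[] := U0_L2; first exact: mD. Qed.

(** Where the density vanishes, the quotient is 0 by convention; by [G_gt0] this concerns almost no
    starting point in the initial domain. *)
Definition transported (x : V) (t : R) : R := u (Phi t 0 x) / G t (Phi t 0 x).

Let G_ge0 t y : I t -> 0 <= G t y.
Proof. by move=> /G_density[]. Qed.

Let mG t : I t -> measurable_fun [set: W] (G t).
Proof. by move=> /G_density[]. Qed.

Let mtransported t : I t -> measurable_fun [set: W] (transported ^~ t : W -> R).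
Proof.
move=> It; have m0 := mPhi It I0.
apply: measurable_funM; first exact: measurableT_comp measurable_u m0.
by apply: measurable_funV => [x|]; [exact: G_ge0|exact: measurableT_comp (mG It) m0].
Qed.

Let transported_flow t y : I t -> transported (Phi 0 t y) t = u y / G t y.
Proof. by move=> It; rewrite /transported (flowK T_gt0 A_C1 LA_gt0 A_jac). Qed.

(** Comparison with time 0, where the density is 1, bounds [G t] below by a positive constant almost
    everywhere. *)
Let G_gt0 t : I t -> {ae lam, forall y, D 0 y -> 0 < G t y}.
Proof.
move=> It.
have := volume_density_le T_gt0 A_C1 LA_gt0 A_jac Omega_open Omega_bounded I0 It
  (G_density I0) (G_density It).
apply: (@filterS _ _ (ae_filter_ringOfSetsType lam)) => y H /H.
rewrite G_init => /(lt_le_trans ltr01).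
by rewrite pmulr_rgt0// volume_growth_gt0.
Qed.

(** The squared norm at time [t] pulled back to the fixed domain [D 0], where different times can be
    compared under one integral. *)
Let energy t : \bar R := (\int[lam]_(y in D 0) (u y ^+ 2 / G t y)%:E)%E.

Let mintegrand t : I t -> measurable_fun (D 0 : set W) (fun y : W => (u y ^+ 2 / G t y)%:E).
Proof.
move=> It; have m : measurable_fun [set: W] (fun y : W => u y ^+ 2 / G t y).
  apply: measurable_funM; first exact: measurable_funX.
  by apply: measurable_funV => [x|]; [exact: G_ge0|exact: mG].
exact/measurable_EFinP/(measurable_funS _ _ m).
Qed.

Let integrand_ge0 t y : I t -> (0 <= (u y ^+ 2 / G t y)%:E)%E.
Proof. by move=> It; rewrite lee_fin divr_ge0 ?sqr_ge0 ?G_ge0. Qed.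

Let energyE t : I t -> (\int[lam]_(x in D t) (transported x t ^+ 2)%:E = energy t)%E.
Proof.
move=> It; have [_ _ HG] := G_density It.
rewrite (HG (fun x => (transported x t ^+ 2)%:E)); last 2 first.
- by move=> x; rewrite lee_fin sqr_ge0.
- by apply/measurable_EFinP; exact: (@measurable_funX _ W R setT _ 2 (mtransported It)).
apply: eq_integral => y _; rewrite transported_flow// -EFinM; congr EFin.
(* With 0 as inverse of 0, the identity (u / G)^2 * G = u^2 / G holds at zeros of the density
   too. *)
have [->|G0] := eqVneq (G t y) 0; first by rewrite invr0 !mulr0.
by field.
Qed.

(** The density stands in the denominator, so the bound of [G s] by a multiple of [G t] reverses
    into a bound of the integrand at [t] by that at [s]. *)
Let energy_le s t : I s -> I t -> (energy t <= (volume_growth d LA t s)%:E * energy s)%E.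
Proof.
move=> Is It; have c0 := volume_growth_gt0 d LA t s.
pose f r (y : W) := (u y ^+ 2 / G r y)%:E.
have cf0 y : (0 <= (volume_growth d LA t s)%:E * f s y)%E.
  by rewrite mule_ge0 ?integrand_ge0// lee_fin ltW.
have mcf : measurable_fun (D 0 : set W) (fun y => (volume_growth d LA t s)%:E * f s y)%E.
  by apply: measurable_funeM; exact: mintegrand.
have -> : ((volume_growth d LA t s)%:E * energy s =
    \int[lam]_(y in D 0) ((volume_growth d LA t s)%:E * f s y))%E.
  rewrite (@ge0_integralZl _ W R lam (D 0) (mD I0) (f s))//; first exact: mintegrand.
  - by move=> y _; exact: integrand_ge0.
  - by rewrite lee_fin ltW.
apply: (@ae_ge0_le_integral _ W R lam (D 0) (mD I0) (f t)) => //.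
- by move=> y _; exact: integrand_ge0.
- exact: mintegrand.
have := volume_density_le T_gt0 A_C1 LA_gt0 A_jac Omega_open Omega_bounded Is It
  (G_density Is) (G_density It).
have Gs := G_gt0 Is; have Gt := G_gt0 It.
move: Gs Gt; apply: (@filterS3 _ _ (ae_filter_ringOfSetsType lam)) => y Gs Gt le Dy.
rewrite -EFinM lee_fin mulrCA ler_wpM2l ?sqr_ge0//.
by rewrite ler_pdivlMr ?Gs// mulrC ler_pdivrMr ?Gt// le.
Qed.

Let energy0_lty : (energy 0 < +oo)%E.
Proof.
have /L2P[|_] := U0_L2; first exact: mD.
apply: le_lt_trans; rewrite le_eqVlt; apply/orP; left; apply/eqP.
apply: eq_integral => y yD; rewrite G_init invr1 mulr1 /u /patch.
by rewrite yD.
Qed.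

Let energy_lty t : I t -> (energy t < +oo)%E.
Proof.
move=> It; apply: le_lt_trans (energy_le I0 It) _.
by apply: lte_mul_pinfty => //; rewrite lee_fin ltW ?volume_growth_gt0.
Qed.

Let energy_ge0 t : I t -> (0 <= energy t)%E.
Proof. by move=> It; apply: integral_ge0 => y _; exact: integrand_ge0. Qed.

Let energy_fin t : I t -> energy t \is a fin_num.
Proof. by move=> It; rewrite ge0_fin_numE ?energy_ge0 ?energy_lty. Qed.

Lemma transported_L2 t : I t -> L2 (D t) (transported ^~ t).
Proof.
move=> It; apply/L2P; first exact: mD.
split; last by rewrite energyE ?energy_lty.
apply/(@measurable_restrictT _ _ W R (D t) (transported ^~ t) (mD It)).
exact: measurable_funS (mtransported It).
Qed.

Let transported_norm t : I t ->
  L2_norm (D t) (transported ^~ t) = (fine (energy t) `^ 2^-1)%:E.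
Proof.
move=> It; rewrite L2_normE; last exact: mD.
by rewrite energyE// -poweR_EFin fineK ?energy_fin.
Qed.

Lemma transported_norm_integrable :
  (@lebesgue_measure R).-integrable I (fun t => L2_norm (D t) (transported ^~ t)).
Proof.
pose k := d.+1%:R * flow_rate d LA.
have k0 : 0 <= k by rewrite mulr_ge0// ltW// mulr_gt0.
have growth s t : volume_growth d LA s t = expR (k * `|t - s|).
  by rewrite /volume_growth -expRM_natl mulrA.
(* Freezing time outside [0, T] makes the discounted energy [h] monotone on the whole line, as
   [nonincreasing_fun] demands. *)
pose clamp (t : R) := Num.max 0 (Num.min t T).
have clampI t : I (clamp t).
  by rewrite /= in_itv/= /clamp le_max lexx/= ge_max ltW//= ge_min lexx orbT.
have clampK t : I t -> clamp t = t.
  by rewrite /= in_itv/= /clamp => /andP[? ?]; rewrite min_l// max_r.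
have clamp_le s t : s <= t -> clamp s <= clamp t.
  by move=> st; rewrite /clamp ge_max !le_max lexx/= le_min !ge_min st lexx !orbT.
pose h t := expR (- k * clamp t) * fine (energy (clamp t)).
have hni : nonincreasing_fun h.
  move=> s t st; rewrite /h; set s' := clamp s; set t' := clamp t.
  have st' : s' <= t' by exact: clamp_le.
  have : fine (energy t') <= expR (k * `|s' - t'|) * fine (energy s').
    rewrite -lee_fin EFinM -growth !fineK; last 2 first.
    - exact/energy_fin/clampI.
    - exact/energy_fin/clampI.
    exact: energy_le (clampI s) (clampI t).
  rewrite ler0_norm ?subr_le0// => le.
  apply: le_trans (ler_wpM2l (expR_ge0 _) le) _.
  rewrite mulrA -expRD; apply: ler_wpM2r; first exact/fine_ge0/energy_ge0/clampI.
  by rewrite ler_expR le_eqVlt; apply/orP; left; apply/eqP; ring.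
have mI : measurable (I : set (measurableTypeR R)) by exact: measurable_itv.
have mh : measurable_fun I h by exact: nonincreasing_measurable.
(* The exponential undoes the discount in [h]: on [0, T] the norm is the square root of a measurable
   factor times a monotone one. *)
pose f t := (expR (k * t) * h t) `^ 2^-1.
have fE t : I t -> f t = fine (energy t) `^ 2^-1.
  move=> It; rewrite /f /h clampK// mulrA -expRD mulNr subrr expR0 mul1r.
  by [].
apply: (@eq_integrable _ _ R lebesgue_measure I mI (EFin \o f)).
  by move=> t /set_mem It; rewrite /= fE// transported_norm.
apply: measurable_bounded_integrable => //.
- by rewrite /= lebesgue_measure_itv/= lte_fin T_gt0 -EFinB ltry.
- apply: (measurableT_comp (measurable_powR _)); apply: measurable_funM => //.
  apply: measurable_funTS; apply: measurableT_comp; first exact: measurable_expR.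
  exact: measurable_funM.
exists ((expR (k * T) * fine (energy 0)) `^ 2^-1); split; first exact: num_real.
move=> M ltM t It /=; rewrite fE// ger0_norm ?powR_ge0//.
apply: le_trans (ltW ltM); apply: ge0_ler_powR.
- by rewrite invr_ge0.
- by rewrite nnegrE; exact: fine_ge0 (energy_ge0 It).
- by rewrite nnegrE mulr_ge0 ?expR_ge0//; exact: fine_ge0 (energy_ge0 I0).
apply: (@le_trans _ _ (expR (k * `|0 - t|) * fine (energy 0))).
  by rewrite -lee_fin EFinM -growth !fineK ?energy_fin//; exact: energy_le.
apply: ler_wpM2r; first exact: fine_ge0 (energy_ge0 I0).
rewrite ler_expR ler_wpM2l//; move: It; rewrite /= in_itv/= => /andP[? ?].
by rewrite sub0r normrN ger0_norm.
Qed.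

(** The conservation law itself: pulled back to time 0, the density cancels, the test function is
    carried by the composed flow [Phi 0 T], and nothing depends on [t] any more. *)
Lemma transported_pairing (Psi : V -> R) t : H0 Omega Psi -> I t ->
  (\int[lam]_(x in D t) (transported x t * test_function T A Psi x t)%:E =
   \int[lam]_(y in D 0) (u y * Psi (Phi 0 T y))%:E)%E.
Proof.
move=> [Psi_L2 _ _] It.
have mPsi : measurable_fun [set: W] (Psi : W -> R).
  by move: Psi_L2 => /L2P[|+ _]; [exact: (@measurableT _ W)|rewrite patch_setT].
have mtest s : I s -> measurable_fun [set: W] (fun x : W => Psi (Phi s T x)).
  by move=> Is; exact: measurableT_comp mPsi (mPhi Is IT).
have [_ _ HG] := G_density It.
rewrite (integral_change_of_variables_signed (f := Phi 0 t : W -> W) _ HG); last 2 first.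
- by move=> y; exact: G_ge0.
- by apply: measurable_funM; [exact: mtransported|exact: mtest].
(* The cancellation [u / G * G = u] is valid only where [G t] is positive, that is almost
   everywhere. *)
apply: ae_eq_integral.
- exact: mD.
- have m0 := mPhi I0 It.
  have m : measurable_fun [set: W] (fun y : W => transported (Phi 0 t y) t *
      test_function T A Psi (Phi 0 t y) t * G t y).
    apply: measurable_funM; last exact: mG.
    by apply: measurable_funM; [exact: (measurableT_comp (mtransported It) m0)
      |exact: (measurableT_comp (mtest _ It) m0)].
  exact/measurable_EFinP/(measurable_funS _ _ m).
- have m : measurable_fun [set: W] (fun y : W => u y * Psi (Phi 0 T y)).
    by apply: measurable_funM; [exact: measurable_u|exact: mtest].
  exact/measurable_EFinP/(measurable_funS _ _ m).
have := G_gt0 It; apply: (@filterS _ _ (ae_filter_ringOfSetsType lam)) => y Gt Dy.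
rewrite transported_flow// /test_function (flow_comp T_gt0 A_C1 LA_gt0 A_jac)//.
by congr EFin; field; rewrite gt_eqF// Gt.
Qed.

Lemma transported_is_solution : is_solution T A Omega U0 transported.
Proof.
split.
- by split=> [t It|]; [exact: transported_L2|exact: transported_norm_integrable].
- apply: aeW => x Dx; rewrite /transported (flow_id T_gt0 A_C1 LA_gt0 A_jac)//.
  by rewrite G_init invr1 mulr1 /u /patch mem_set.
move=> Psi HPsi t It.
(* The pairing is constant on [0, T], so the difference quotient is identically 0 there, before any
   limit. *)
apply: (cvg_trans _ (cvg_cst (0 : R^o) (F := within I t^'))).
apply: near_eq_cvg.
change (\forall s \near t, s != t -> I s -> (0 : R) = (s - t)^-1 *:
  ((\int[lam]_(x in D s) (transported x s * test_function T A Psi x s)) -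
   (\int[lam]_(x in D t) (transported x t * test_function T A Psi x t)))).
apply: (@filterE _ (nbhs t)) => s _ Is.
by rewrite /Rintegral !transported_pairing// subrr scaler0.
Qed.

End Existence.

Unset Implicit Arguments.
Set Strict Implicit.

Theorem theorem5p1 (R : realType) (d : nat) (T : R) (Omega : set 'rV[R]_d.+1)
    (A : 'rV[R]_d.+1 -> R -> 'rV[R]_d.+1) (LA : R) (U0 : 'rV[R]_d.+1 -> R)
    (T_gt0 : 0 < T)
    (Omega_open : open Omega) (Omega_bounded : bounded_set Omega)
    (A_C1 : C1_on_slab T A) (LA_gt0 : 0 < LA)
    (A_jac : (ereal_sup [set (operator_norm (spatial_jacobian A z.1 z.2))%:E |
                z in [set: 'rV[R]_d.+1] `*` `[0%R, T]] <= LA%:E)%E)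
    (U0_L2 : L2 (moving_domain T A Omega 0) U0) :
  exists U : 'rV[R]_d.+1 -> R -> R, is_solution T A Omega U0 U.
Proof.
(* One density is selected for each time separately; [cst 0] fills in times outside [0, T]. *)
have /choice[G GP] t : exists G, `[0, T]%classic t ->
    is_volume_density T A Omega t G /\ (t = 0 -> G = cst 1).
  have [It|nIt] := pselect (`[0, T]%classic t); last by exists (cst 0).
  have [G ? ?] := volume_density_exists T_gt0 A_C1 LA_gt0 A_jac Omega_open Omega_bounded It.
  by exists G.
have I0 : `[0, T]%classic 0 by rewrite /= in_itv/= lexx ltW.
exists (transported T A Omega U0 G).
apply: (transported_is_solution T_gt0 A_C1 LA_gt0 A_jac Omega_open Omega_bounded U0_L2).
  by move=> t /GP[].
by have [_ ->] := GP 0 I0.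
Qed.
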